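(* The Hochschild homology $HH_1(A)$ has a $\mathbf{k}$-basis consisting of the homology classes of the following elements of $A\otimes V_1$ (as a set of elements): (i) $\alpha_1(n)=x^{n-1}\otimes x$; (ii) $\beta_1(n)=y^{n-1}\otimes y$; (iii) $\gamma_1(n)=z^{n-1}\otimes z$; (iv) $\theta_1(n_{1,p};m_{1,p})=\sum_{u,v,w} wu\otimes v$, where $n,p,n_1,\dots,n_p,m_1,\dots,m_p$ range over positive integers, and the sum in (iv) is over all $u,w\in\mathcal B$ and $v\in\{x,y,z\}$ such that $uvw=xy^{n_1}z^{m_1}xy^{n_2}z^{m_2}\cdots xy^{n_p}z^{m_p}$ in the free algebra $\mathbf{k}\langle x,y,z\rangle$.
   Context: $\mathbf{k}$ is a field of characteristic $0$, $A=\mathbf{k}\langle x,y,z\rangle/(x^2+yx,\,xz,\,zy)$, $A^e=A\otimes A^{\mathrm{op}}$, and $HH_n(A)=\mathrm{Tor}_n^{A^e}(A,A)$. The notation $n_{1,p}$ stands for the sequence $n_1,\dots,n_p$. $\mathcal B$ is the $\mathbf{k}$-basis of $A$ formed by all words (including the empty word $1$) in $x,y,z$ that contain none of $xy^kx$ ($k\ge 0$), $xz$, $zy$ as a subword. $A$ is Koszul, and $HH_\bullet(A)$ is computed as the homology of the complex $0\to A\otimes V_4\xrightarrow{d_4}A\otimes V_3\xrightarrow{d_3}A\otimes V_2\xrightarrow{d_2}A\otimes V_1\xrightarrow{d_1}A\to 0$ (obtained by applying $A\otimes_{A^e}-$ to the two-sided Koszul resolution), where $V_1=\mathbf{k}\{x,y,z\}$,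 $V_2=\mathbf{k}\{(x+y)x,xz,zy\}$, $V_3=\mathbf{k}\{(x+y)xz,xzy\}$, $V_4=\mathbf{k}\{(x+y)xzy\}$ and $d_1(a\otimes p)=ap-pa$ for $p=x,y,z$; $d_2(a\otimes (x+y)x)=a(x+y)\otimes x+xa\otimes x+xa\otimes y$, $d_2(b\otimes xz)=bx\otimes z+zb\otimes x$, $d_2(c\otimes zy)=cz\otimes y+yc\otimes z$; $d_3(b\otimes(x+y)xz)=b(x+y)\otimes xz-zb\otimes(x+y)x$, $d_3(a\otimes xzy)=ax\otimes zy-ya\otimes xz$; $d_4(a\otimes(x+y)xzy)=a(x+y)\otimes xzy+ya\otimes(x+y)xz$. *)

(* Defs.v *)
From HB Require Import structures.
From mathcomp Require Import all_boot all_algebra boolp.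
From mathcomp Require Import finmap monalg.

Set Implicit Arguments.
Unset Strict Implicit.
Unset Printing Implicit Defensive.

Import GRing.Theory.
Local Open Scope ring_scope.
Local Open Scope quotient_scope.

Section QuotientLmodule.
Variables (R : pzRingType) (V : lmodType R) (W : submodClosed V).

(* [submodClosed] does not provide the [zmodClosed] structure required by
   [Quotient.quot], hence this alias of [W]. *)
Definition lquot_pred : {pred V} := fun v => v \in W.

Fact lquot_pred_closed : zmod_closed lquot_pred.
Proof. exact: GRing.submod_closedB (submodClosedP W). Qed.
HB.instance Definition _ := GRing.isZmodClosed.Build V lquot_pred
  lquot_pred_closed.

Definition lquot := Quotient.quot lquot_pred.
HB.instance Definition _ := EqQuotient.on lquot.
HB.instance Definition _ := ZmodQuotient.on lquot.
HB.instance Definition _ := GRing.Zmodule.on lquot.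
Local Notation Q := lquot.

Lemma eq_lquot (u v : V) : (\pi_Q u == \pi_Q v) = (u - v \in W).
Proof. by rewrite -Quotient.idealrBE. Qed.

Definition quot_scale (c : R) : Q -> Q := lift_op1 Q ( *:%R c).

Lemma pi_quot_scale c : {morph \pi_Q : v / c *: v >-> quot_scale c v}.
Proof.
move=> v; unlock quot_scale; apply/eqP; rewrite eq_lquot -scalerBr.
by rewrite rpredZ // -eq_lquot reprK.
Qed.

Fact quot_scaleA a b v : quot_scale a (quot_scale b v) = quot_scale (a * b) v.
Proof. by rewrite -[v]reprK -!pi_quot_scale scalerA. Qed.

Fact quot_scale1 : left_id 1 quot_scale.
Proof. by move=> v; rewrite -[v]reprK -!pi_quot_scale scale1r. Qed.

Fact quot_scaleDr : right_distributive quot_scale +%R.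
Proof.
move=> c u v; rewrite -[u]reprK -[v]reprK -raddfD -!pi_quot_scale.
by rewrite scalerDr raddfD.
Qed.

Fact quot_scaleDl v : {morph quot_scale^~ v : a b / a + b}.
Proof.
by move=> a b; rewrite -[v]reprK -!pi_quot_scale scalerDl raddfD.
Qed.

HB.instance Definition _ := GRing.Zmodule_isLmodule.Build R Q
  quot_scaleA quot_scale1 quot_scaleDr quot_scaleDl.

Definition lquot_proj (v : V) : lquot := \pi v.

Fact lquot_proj_linear : linear lquot_proj.
Proof. by move=> c u v; rewrite /lquot_proj raddfD /= pi_quot_scale. Qed.
HB.instance Definition _ := GRing.isLinear.Build R V lquot *:%R lquot_proj
  lquot_proj_linear.

End QuotientLmodule.

Section Homology.
Variables (R : pzRingType) (U V W : lmodType R).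
Variables (f : {linear U -> V}) (g : {linear V -> W}).

Definition kernel : {pred V} := fun v => g v == 0.

Fact kernel_closed : submod_closed kernel.
Proof.
split=> [|c u v]; rewrite !unfold_in /kernel ?raddf0 //.
by move=> /eqP gu /eqP gv; rewrite linearP gu gv scaler0 addr0.
Qed.
HB.instance Definition _ := GRing.isSubmodClosed.Build R V kernel
  (GRing.submod_closed_semi kernel_closed).

Definition cycle := {v : V | v \in kernel}.
HB.instance Definition _ := Choice.on cycle.
HB.instance Definition _ := SubType.on cycle.
HB.instance Definition _ := [SubChoice_isSubLmodule of cycle by <:].

Definition boundary : {pred cycle} := fun z => `[< exists u, f u = val z >].

Fact boundary_closed : submod_closed boundary.
Proof.
split=> [|c y z]; first by apply/asboolP; exists 0; rewrite !raddf0.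
move=> /asboolP[u fu] /asboolP[v fv]; apply/asboolP; exists (c *: u + v).
by rewrite linearP fu fv linearP.
Qed.
HB.instance Definition _ :=
  GRing.isSubmodClosed.Build R cycle boundary
  (GRing.submod_closed_semi boundary_closed).

(* No hypothesis [g \o f =1 0] is needed: [boundary] only collects the values
   of [f] that are cycles. *)
Definition homology := lquot boundary.
HB.instance Definition _ := GRing.Lmodule.on homology.

Definition hclass (z : cycle) : homology := \pi z.

End Homology.

(* [f] restricted to [D] is injective and its values form a basis of the
   possibly infinite-dimensional space [V]. *)
Definition basis_on (K : fieldType) (V : lmodType K) (I : choiceType)
    (D : I -> Prop) (f : I -> V) : Prop :=
  (forall (s : seq I) (c : I -> K), uniq s -> {in s, forall i, D i} ->
     \sum_(i <- s) c i *: f i = 0 -> {in s, forall i, c i = 0}) /\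
  (forall v : V, exists (s : seq I) (c : I -> K),
     {in s, forall i, D i} /\ v = \sum_(i <- s) c i *: f i).

Section IdealQuotient.
Variables (K : fieldType) (F : algType K) (I : Type) (rel : I -> F).

Definition ideal_gen : {pred F} := fun p =>
  `[< exists s : seq (F * I * F), p = \sum_(t <- s) t.1.1 * rel t.1.2 * t.2 >].

Fact ideal_gen_closed : submod_closed ideal_gen.
Proof.
split=> [|c p q]; first by apply/asboolP; exists [::]; rewrite big_nil.
move=> /asboolP[s ->] /asboolP[t ->]; apply/asboolP.
exists ([seq (c *: u.1.1, u.1.2, u.2) | u <- s] ++ t).
rewrite big_cat big_map /= scaler_sumr; congr (_ + _).
by apply: eq_bigr => u _; rewrite -!scalerAl.
Qed.
HB.instance Definition _ :=
  GRing.isSubmodClosed.Build K F ideal_gen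
  (GRing.submod_closed_semi ideal_gen_closed).

Lemma ideal_genMl p q : q \in ideal_gen -> p * q \in ideal_gen.
Proof.
move=> /asboolP[s ->]; apply/asboolP.
exists [seq (p * u.1.1, u.1.2, u.2) | u <- s]; rewrite big_map mulr_sumr.
by apply: eq_bigr => u _; rewrite /= !mulrA.
Qed.

Lemma ideal_genMr p q : p \in ideal_gen -> p * q \in ideal_gen.
Proof.
move=> /asboolP[s ->]; apply/asboolP.
exists [seq (u.1.1, u.1.2, u.2 * q) | u <- s]; rewrite big_map mulr_suml.
by apply: eq_bigr => u _; rewrite /= !mulrA.
Qed.

Lemma ideal_gen_rel i : rel i \in ideal_gen.
Proof.
by apply/asboolP; exists [:: (1, i, 1)]; rewrite big_seq1 /= mul1r mulr1.
Qed.

(* Algebras are nontrivial, so the ideal has to be proper. *)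
Hypothesis proper : 1 \notin ideal_gen.

Definition quotalg of 1 \notin ideal_gen := lquot ideal_gen.
Local Notation Q := (quotalg proper).
HB.instance Definition _ := EqQuotient.on Q.
HB.instance Definition _ := ZmodQuotient.on Q.
HB.instance Definition _ := GRing.Lmodule.on Q.

Definition qmul : Q -> Q -> Q := lift_op2 Q *%R.

Lemma pi_qmul : {morph \pi_Q : p q / p * q >-> qmul p q}.
Proof.
move=> p q; unlock qmul; apply/eqP; rewrite eq_lquot.
set p' := repr _; set q' := repr _.
have -> : p * q - p' * q' = (p - p') * q + p' * (q - q').
  by rewrite mulrBl mulrBr addrA subrK.
by apply: rpredD; [apply: ideal_genMr | apply: ideal_genMl];
  rewrite -eq_lquot reprK.
Qed.

Fact qmulA : associative qmul.
Proof.
move=> a b c; rewrite -[a]reprK -[b]reprK -[c]reprK.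
by rewrite -!pi_qmul mulrA.
Qed.

Fact qmul1l : left_id (\pi_Q 1) qmul.
Proof. by move=> a; rewrite -[a]reprK -!pi_qmul mul1r. Qed.

Fact qmul1r : right_id (\pi_Q 1) qmul.
Proof. by move=> a; rewrite -[a]reprK -!pi_qmul mulr1. Qed.

Fact qmulDl : left_distributive qmul +%R.
Proof.
move=> a b c; rewrite -[a]reprK -[b]reprK -[c]reprK.
by rewrite -raddfD -!pi_qmul mulrDl raddfD.
Qed.

Fact qmulDr : right_distributive qmul +%R.
Proof.
move=> a b c; rewrite -[a]reprK -[b]reprK -[c]reprK.
by rewrite -raddfD -!pi_qmul mulrDr raddfD.
Qed.

Fact qone_neq0 : \pi_Q 1 != 0 :> Q.
Proof.
by rewrite -(raddf0 \pi_Q) eq_lquot subr0 proper.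
Qed.

HB.instance Definition _ := GRing.Zmodule_isNzRing.Build Q
  qmulA qmul1l qmul1r qmulDl qmulDr qone_neq0.

Definition qproj : F -> Q := @lquot_proj K F ideal_gen.
HB.instance Definition _ := GRing.Linear.on qproj.

Fact qproj_monoid_morphism : monoid_morphism qproj.
Proof. by split=> // p q; rewrite /qproj /lquot_proj pi_qmul. Qed.
HB.instance Definition _ := GRing.isMonoidMorphism.Build F Q qproj
  qproj_monoid_morphism.

Lemma qproj_surj (a : Q) : exists p, qproj p = a.
Proof. by exists (repr a); rewrite /qproj /lquot_proj reprK. Qed.

Lemma qproj_eq0 p : (qproj p == 0) = (p \in ideal_gen).
Proof. by rewrite -(raddf0 qproj) /qproj /lquot_proj eq_lquot subr0. Qed.

Fact quotalg_scalerAl (c : K) (a b : Q) : c *: (a * b) = (c *: a) * b.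
Proof.
have [p <-] := qproj_surj a; have [q <-] := qproj_surj b.
by rewrite -rmorphM -!linearZ -rmorphM /= scalerAl.
Qed.
HB.instance Definition _ :=
  GRing.Lmodule_isLalgebra.Build K Q quotalg_scalerAl.

Fact quotalg_scalerAr (c : K) (a b : Q) : c *: (a * b) = a * (c *: b).
Proof.
have [p <-] := qproj_surj a; have [q <-] := qproj_surj b.
by rewrite -rmorphM -!linearZ -rmorphM /= scalerAr.
Qed.
HB.instance Definition _ :=
  GRing.Lalgebra_isAlgebra.Build K Q quotalg_scalerAr.

End IdealQuotient.

Variant letter := X | Y | Z.

Definition letter_code (l : letter) : 'I_3 :=
  match l with X => inord 0 | Y => inord 1 | Z => inord 2 end.
Definition letter_decode (i : 'I_3) : letter :=
  match val i with 0 => X | 1 => Y | _ => Z end.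
Fact letter_codeK : cancel letter_code letter_decode.
Proof. by case; rewrite /letter_decode /= inordK. Qed.
HB.instance Definition _ := Finite.copy letter (can_type letter_codeK).

(* [Rxx], [Rxz], [Rzy] index both the defining relations of [A] and the basis
   [(x+y)x], [xz], [zy] of [V_2]. *)
Variant relation := Rxx | Rxz | Rzy.

Definition relation_code (r : relation) : 'I_3 :=
  match r with Rxx => inord 0 | Rxz => inord 1 | Rzy => inord 2 end.
Definition relation_decode (i : 'I_3) : relation :=
  match val i with 0 => Rxx | 1 => Rxz | _ => Rzy end.
Fact relation_codeK : cancel relation_code relation_decode.
Proof. by case; rewrite /relation_decode /= inordK. Qed.
HB.instance Definition _ := Finite.copy relation (can_type relation_codeK).

Section Algebra.
Variable k : fieldType.

Definition freealg := {malg k[{fmonom letter}]}.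
HB.instance Definition _ := GRing.Lalgebra.on freealg.

Fact freealg_scalerAr (c : k) (p q : freealg) : c *: (p * q) = p * (c *: q).
Proof.
have comm_c (m : freealg) : (c%:MP : freealg) * m = m * c%:MP.
  rewrite mul_malgC [RHS]fgmulgU.
  rewrite [in LHS](monalgE m) scaler_sumr; apply: eq_bigr => l _.
  by rewrite mulm1 -mul_malgC [LHS]fgmulUU mul1m mulrC.
by rewrite -!mul_malgC mulrA comm_c -mulrA.
Qed.
HB.instance Definition _ :=
  GRing.Lalgebra_isAlgebra.Build k freealg freealg_scalerAr.

Definition fgen (l : letter) : freealg := << fmu l >>.

Definition relator (r : relation) : freealg :=
  match r with
  | Rxx => fgen X ^+ 2 + fgen Y * fgen X
  | Rxz => fgen X * fgen Z
  | Rzy => fgen Z * fgen Y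
  end.

Lemma relator_proper : 1 \notin ideal_gen relator.
Proof.
pose eps : {rmorphism freealg -> k} := @mcoeff _ _ (@mone {fmonom letter}).
have eps_gen l : eps (fgen l) = 0.
  rewrite /eps /= mcoeffU1; case: eqP => // /(congr1 (@fdeg _)).
  by rewrite fdegU fdeg1.
have eps_rel r : eps (relator r) = 0.
  have epsM l m : eps (fgen l * fgen m) = 0 by rewrite rmorphM eps_gen mul0r.
  case: r; [|exact: epsM|exact: epsM].
  rewrite (rmorphD eps (fgen X * fgen X)).
  exact: etrans (congr2 +%R (epsM _ _) (epsM _ _)) (addr0 0).
apply/asboolP => -[s] /(congr1 eps) /eqP.
rewrite rmorph1 rmorph_sum big1 ?oner_eq0 // => t _.
by rewrite rmorphM [eps (_ * _)]rmorphM eps_rel mulr0 mul0r.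
Qed.

Definition Aalg := quotalg relator_proper.
HB.instance Definition _ := GRing.Algebra.on Aalg.

End Algebra.

Section Koszul.
Variable k : fieldType.
Local Notation A := (Aalg k).

Local Notation pi := (qproj (relator_proper k)).

Definition gen (l : letter) : A := pi (fgen k l).
Local Notation x := (gen X).
Local Notation y := (gen Y).
Local Notation z := (gen Z).

(* If [B] is a basis of [V] then [A (x) V] is the module of functions [B -> A];
   [a (x) b] is the function that maps [b] to [a] and the rest of [B] to [0]. *)
Definition AV1 := {ffun letter -> A}.
Definition AV2 := {ffun relation -> A}.

Definition tens (a : A) (l : letter) : AV1 :=
  [ffun l' => if l' == l then a else 0].

Definition d1 (c : AV1) : A := \sum_l (c l * gen l - gen l * c l).

Definition d2_gen (a : A) (r : relation) : AV1 :=
  match r with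
  | Rxx => tens (a * (x + y)) X + tens (x * a) X + tens (x * a) Y
  | Rxz => tens (a * x) Z + tens (z * a) X
  | Rzy => tens (a * z) Y + tens (y * a) Z
  end.

Definition d2 (c : AV2) : AV1 := \sum_r d2_gen (c r) r.

Fact d1_linear : linear d1.
Proof.
move=> c u v; rewrite /d1 scaler_sumr -big_split; apply: eq_bigr => l _ /=.
rewrite !ffunE mulrDl mulrDr -scalerAl -scalerAr scalerBr opprD.
by rewrite addrACA.
Qed.
HB.instance Definition _ := GRing.isLinear.Build k AV1 A *:%R d1 d1_linear.

Fact tens_linear l : linear (tens^~ l).
Proof.
move=> c a b; apply/ffunP => l'; rewrite !ffunE.
by case: ifP => _; rewrite ?scaler0 ?addr0.
Qed.

Fact d2_gen_linear r : linear (d2_gen^~ r).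
Proof.
move=> c a b; rewrite /d2_gen; move: (x + y) => s.
have linMr u : linear (fun v : A => v * u).
  by move=> e v w; rewrite mulrDl scalerAl.
have linMl u : linear (fun v : A => u * v).
  by move=> e v w; rewrite mulrDr scalerAr.
case: r.
- rewrite (linMr s c a b) (linMl x c a b) !tens_linear.
  by rewrite !scalerDr (addrACA (c *: _)) (addrACA (c *: _ + c *: _)).
- rewrite (linMr x c a b) (linMl z c a b) !tens_linear.
  by rewrite scalerDr addrACA.
- rewrite (linMr z c a b) (linMl y c a b) !tens_linear.
  by rewrite scalerDr addrACA.
Qed.

Fact d2_linear : linear d2.
Proof.
move=> c u v; rewrite /d2 scaler_sumr -big_split; apply: eq_bigr => r _ /=.
by rewrite !ffunE d2_gen_linear.
Qed.
HB.instance Definition _ := GRing.isLinear.Build k AV2 AV1 *:%R d2 d2_linear.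

Lemma Arel_xx : x * x + y * x = 0.
Proof.
rewrite -!(rmorphM pi).
apply: etrans (esym (rmorphD pi (fgen k X * fgen k X) (fgen k Y * fgen k X))) _.
by apply/eqP; rewrite qproj_eq0; exact: (ideal_gen_rel (@relator k) Rxx).
Qed.

Lemma Arel_xz : x * z = 0.
Proof.
rewrite -(rmorphM pi).
by apply/eqP; rewrite qproj_eq0; exact: (ideal_gen_rel (@relator k) Rxz).
Qed.

Lemma Arel_zy : z * y = 0.
Proof.
rewrite -(rmorphM pi).
by apply/eqP; rewrite qproj_eq0; exact: (ideal_gen_rel (@relator k) Rzy).
Qed.

Lemma d1_d2 (c : AV2) : d1 (d2 c) = 0.
Proof.
have d1_tens a l : d1 (tens a l) = a * gen l - gen l * a.
  rewrite /d1 (bigD1 l) //= big1 ?addr0 ?ffunE ?eqxx // => l' ne.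
  by rewrite ffunE (negPf ne) mul0r mulr0 subr0.
have e1 a : a * (x * x) + a * (y * x) = 0 by rewrite -mulrDr Arel_xx mulr0.
have e2 a : x * (x * a) = - (y * (x * a)).
  by apply/eqP; rewrite -addr_eq0 !mulrA -mulrDl Arel_xx mul0r.
rewrite /d2 linear_sum big1 // => r _; move: (c r) => a; case: r => /=.
- rewrite !linearD /= !d1_tens mulrDr mulrDl -!mulrA mulrDr e1 sub0r.
  by rewrite e2 opprK -addrA addrACA subrr addr0 addNr.
- rewrite linearD /= !d1_tens -!mulrA Arel_xz mulr0 sub0r.
  by rewrite addKr [x * _]mulrA Arel_xz mul0r oppr0.
- rewrite linearD /= !d1_tens -!mulrA Arel_zy mulr0 sub0r.
  by rewrite addKr [z * _]mulrA Arel_zy mul0r oppr0.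
Qed.

(* [A] is Koszul and [A (x) V_n] is obtained by applying [A (x)_(A^e) -] to its
   two-sided Koszul resolution, so [Tor_1^(A^e)(A, A)] is [ker d1 / im d2]. *)
Definition Z1 := cycle d1.
Definition HH1 := homology d2 d1.
Definition HH1_class (c : Z1) : HH1 := hclass d2 c.

(* Membership in the monomial basis of [A]. A factor [X Y^j X] of [w] has
   [j < size w], so bounding [j] loses nothing. *)
Definition in_basis (w : seq letter) : bool :=
  [&& ~~ infix [:: X; Z] w, ~~ infix [:: Z; Y] w
    & [forall j : 'I_(size w), ~~ infix (X :: nseq j Y ++ [:: X]) w]].

Definition wordA (w : seq letter) : A := \prod_(l <- w) gen l.

Definition alpha1 (n : nat) : AV1 := tens (x ^+ n.-1) X.
Definition beta1 (n : nat) : AV1 := tens (y ^+ n.-1) Y.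
Definition gamma1 (n : nat) : AV1 := tens (z ^+ n.-1) Z.

Definition theta_word (p : nat) (n m : 'I_p -> nat) : seq letter :=
  \big[cat/[::]]_(i < p) (X :: nseq (n i) Y ++ nseq (m i) Z).

(* The factorizations [W = u v w] with [v] a letter correspond to the positions
   [i] in [W]: [u = take i W], [v] is the letter at [i], [w = drop i.+1 W]. *)
Definition theta1 (p : nat) (n m : 'I_p -> nat) : AV1 :=
  let W := theta_word n m in
  \sum_(i < size W | in_basis (take i W) && in_basis (drop i.+1 W))
     tens (wordA (drop i.+1 W) * wordA (take i W)) (tnth (in_tuple W) i).

Variant HH1_basis_elt : AV1 -> Prop :=
| Alpha1 n of (0 < n)%N : HH1_basis_elt (alpha1 n)
| Beta1 n of (0 < n)%N : HH1_basis_elt (beta1 n)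
| Gamma1 n of (0 < n)%N : HH1_basis_elt (gamma1 n)
| Theta1 p (n m : 'I_p -> nat) of (0 < p)%N & (forall i, 0 < n i)%N
    & (forall i, 0 < m i)%N : HH1_basis_elt (theta1 n m).

End Koszul.

(* Main.v *)
Require Import Defs.
From mathcomp Require Import all_boot all_algebra.
From HB Require Import structures.
From mathcomp Require Import boolp finmap monalg zify.

(** Put [s = x + y].  Modulo the image of [d_2], the cyclic derivative
    [w_1...w_n |-> sum_i w_(i+1)...w_n w_1...w_(i-1) (x) w_i] only depends on the
    class of a word in [A], up to rotation.  Replacing each [s] by [x] after [z]
    and by [y] after [s], the cyclic derivative of a word in [s] and [z] becomes
    a combination of basis elements.  In terms of [s], [x], [z] the relations
    are [sx = xz = 0] and [zx = zs], and the monomials [x^a c], with [c] a word in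
    [s] and [z] without [zsz] that does not start with [z] if [a > 0], form a basis
    of [A]; on this basis one defines explicitly a linear map [T : A -> A (x) V_1] such that [v - T (d_1 v)] is always a combination
    of boundaries and cyclic derivatives, hence so is every cycle [v].  Linear
    independence is seen with functionals on [A (x) V_1] that vanish on the image of
    [d_2]: counting the [a (x) v] with [v <> x] such that [av] is a rotation of a given
    word, and, for the [alpha_1], the map [x |-> t], [y |-> -t], [z |-> 0] to [k[t]]. *)

Set Implicit Arguments.
Unset Strict Implicit.
Unset Printing Implicit Defensive.

Import GRing.Theory.
Local Open Scope ring_scope.

(** * Linear maps out of a free module *)

Section LinearExtension.
Variables (K : choiceType) (k : fieldType) (V : lmodType k).

Lemma malg_linear_eq (f g : {malg k[K]} -> V) :
  linear f -> linear g -> (forall a, f << a >> = g << a >>) -> f =1 g.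
Proof.
move=> lf lg fg u.
have h0 (h : {malg k[K]} -> V) : linear h -> h 0 = 0.
  by move=> lh; have := lh (-1) 0 0; rewrite scaler0 addr0 scaleN1r addNr.
rewrite [u]monalgE; elim: (X in \sum_(a <- X) _) => [|a s IH].
  by rewrite big_nil !h0.
rewrite big_cons; have -> : << u@_a *g a >> = u@_a *: << a >> :> {malg k[K]}.
  by apply/malgP => b; rewrite mcoeffZ !mcoeffU mulrnAr mulr1.
by rewrite lf lg fg IH.
Qed.

Variable f : K -> V.

Definition lext (g : {malg k[K]}) : V := \sum_(a <- msupp g) g@_a *: f a.

Lemma lextEw (d : {fset K}) g : (msupp g `<=` d)%fset ->
  lext g = \sum_(a <- d) g@_a *: f a.
Proof.
move=> le; rewrite [LHS](big_fset_incl _ le) => //= x xd /mcoeff_outdom ->.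
by rewrite scale0r.
Qed.

Lemma lextU a : lext << a >> = f a.
Proof. by rewrite (lextEw (msuppU_le (x := 1))) big_seq_fset1 mcoeffUU scale1r. Qed.

Fact lext_linear : linear lext.
Proof.
move=> c g1 g2 /=; pose E := (msupp (c *: g1 + g2) `|` msupp g1 `|` msupp g2)%fset.
rewrite 3?(lextEw (d := E)) /E;
  try by apply/fsubsetP => a; rewrite !inE => -> //; rewrite ?orbT.
rewrite scaler_sumr -big_split; apply: eq_bigr => a _ /=.
by rewrite mcoeffD mcoeffZ scalerDl scalerA.
Qed.
HB.instance Definition _ :=
  GRing.isLinear.Build k {malg k[K]} V *:%R lext lext_linear.

End LinearExtension.

(** * Linear maps on [A] prescribed on words *)

Section WordLift.
Variable k : fieldType.
Local Notation A := (Aalg k).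
Local Notation pi := (qproj (relator_proper k)).

Definition fword (w : seq letter) : freealg k := locked << FMonom w >>.

Lemma fwordE w : fword w = << FMonom w >>.
Proof. by rewrite /fword -lock. Qed.

Lemma fword_cat u v : fword (u ++ v) = fword u * fword v.
Proof.
rewrite !fwordE [RHS]fgmulUU mulr1; congr (mkmalgU _ _).
by apply/eqP; rewrite fmP fmM.
Qed.

Lemma fgenE l : fgen k l = fword [:: l].
Proof. by rewrite fwordE /fgen fmuE. Qed.

Lemma fword_cat3 u v w : fword (u ++ v ++ w) = fword u * fword v * fword w.
Proof. by rewrite fword_cat (fword_cat v) mulrA. Qed.

Lemma fword2 l m : fword [:: l; m] = fgen k l * fgen k m.
Proof. by rewrite (fword_cat [:: l]) !fgenE. Qed.

Lemma relator_xxE : relator k Rxx = fword [:: X; X] + fword [:: Y; X].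
Proof. by rewrite !fword2. Qed.

Lemma relator_xzE : relator k Rxz = fword [:: X; Z].
Proof. by rewrite fword2. Qed.

Lemma relator_zyE : relator k Rzy = fword [:: Z; Y].
Proof. by rewrite fword2. Qed.

Lemma relator_xx_sandwich u v : fword u * relator k Rxx * fword v =
  fword (u ++ [:: X; X] ++ v) + fword (u ++ [:: Y; X] ++ v).
Proof. by rewrite !fword_cat3 relator_xxE mulrDr mulrDl. Qed.

Lemma pi_fword w : pi (fword w) = wordA k w.
Proof.
elim: w => [|l w IH].
  by rewrite /wordA big_nil fwordE -fmoneE; exact: rmorph1.
by rewrite /wordA big_cons -/(wordA k w) -IH -cat1s fword_cat rmorphM -fgenE.
Qed.

Lemma freealg_linear_eq (V : lmodType k) (f g : freealg k -> V) :
  linear f -> linear g -> (forall w, f (fword w) = g (fword w)) -> f =1 g.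
Proof. by move=> lf lg fg; apply: malg_linear_eq => // -[w]; rewrite -fwordE. Qed.

Lemma linear_wordA_eq (V : lmodType k) (f g : A -> V) :
  linear f -> linear g -> (forall w, f (wordA k w) = g (wordA k w)) -> f =1 g.
Proof.
move=> lf lg fg a; have [p <-] := @qproj_surj _ _ _ _ (relator_proper k) a.
have lfp : linear (f \o pi) by move=> c u v; rewrite /= linearP lf.
have lgp : linear (g \o pi) by move=> c u v; rewrite /= linearP lg.
by apply: (freealg_linear_eq lfp lgp) => w; rewrite /= pi_fword.
Qed.

Variables (V : lmodType k) (F : seq letter -> V).
Hypothesis Fxx : forall p q, F (p ++ [:: X; X] ++ q) + F (p ++ [:: Y; X] ++ q) = 0.
Hypothesis Fxz : forall p q, F (p ++ [:: X; Z] ++ q) = 0.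
Hypothesis Fzy : forall p q, F (p ++ [:: Z; Y] ++ q) = 0.

(** By linearity in both outer factors, the extension of [F] to the free algebra kills every
    [p * relator k r * q] once it does so for words [p] and [q], and there the hypotheses on [F]
    apply. So it kills the ideal and descends to [A]. *)
Lemma wordA_lift_ex : exists T : {linear A -> V}, forall w, T (wordA k w) = F w.
Proof.
have [T0 T0w] : exists T0 : {linear freealg k -> V}, forall w, T0 (fword w) = F w.
  exists (lext (fun m : {fmonom letter} => F m)) => w.
  by rewrite fwordE /= lextU.
have T0D (a b : freealg k) : T0 (a + b : freealg k) = T0 a + T0 b by exact: raddfD.
have T3 u v w : T0 (fword u * fword v * fword w : freealg k) = F (u ++ v ++ w).
  by rewrite -T0w; congr (T0 _); rewrite fword_cat3.
have T0rel p r q : T0 (p * relator k r * q : freealg k) = 0.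
  have l0 : linear (fun=> 0 : V) by move=> c ? ?; rewrite scaler0 addr0.
  have lp : linear (fun p => T0 (p * relator k r * q : freealg k)).
    by move=> c u v; rewrite !mulrDl -!scalerAl linearP.
  apply: (freealg_linear_eq lp (l0 _)) => u.
  have lq : linear (fun q => T0 (fword u * relator k r * q : freealg k)).
    by move=> c v w; rewrite mulrDr -scalerAr linearP.
  apply: (freealg_linear_eq lq (l0 _)); clear lp lq.
  move=> v; case: r.
  - by rewrite relator_xx_sandwich T0D !T0w.
  - by rewrite relator_xzE (T3 u [:: X; Z] v).
  - by rewrite relator_zyE (T3 u [:: Z; Y] v).
have T0s (s : seq (freealg k * relation * freealg k)) :
    T0 (\sum_(t <- s) t.1.1 * relator k t.1.2 * t.2) = 0.
  elim: s => [|t s IH]; first by rewrite big_nil; exact: raddf0.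
  by rewrite big_cons T0D IH addr0; exact: T0rel.
have T0id p q : pi p = pi q -> T0 p = T0 q.
  move=> /eqP; rewrite -subr_eq0 -linearB qproj_eq0 => /asboolP[s pq].
  by have := T0s s; rewrite -pq => pq0; rewrite -[p](subrK q) T0D pq0 add0r.
have reprKK (a : A) : pi (generic_quotient.repr a) = a by exact: generic_quotient.reprK.
(* Since [T0] is constant on classes, its value at the chosen representative is linear in the
   class. *)
pose T (a : A) : V := T0 (generic_quotient.repr a).
have linT : linear T.
  move=> c a b; rewrite /T -linearP; apply: T0id.
  apply: etrans (reprKK _) _; apply: esym; apply: etrans (linearP _ _ _ _) _.
  by congr (_ *: _ + _); exact: reprKK.
pose T' : {linear A -> V} := HB.pack T (GRing.isLinear.Build _ _ _ _ T linT).
by exists T' => w; rewrite -T0w -pi_fword; apply: T0id; rewrite reprKK.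
Qed.

End WordLift.

(** * Pure tensors with an arbitrary second factor *)

Section TensorForm.
Variables (k : fieldType) (V : lmodType k) (I : finType).
Implicit Types (a b : V) (f g : {ffun I -> k^o}).

(** The vector [f] holds coordinates on the basis [I]; besides single letters this admits [x + y],
    [- x] and [0] as second factor. *)
Definition ftens a f : {ffun I -> V} := [ffun i => f i *: a].

Lemma ftensDl a b f : ftens (a + b) f = ftens a f + ftens b f.
Proof. by apply/ffunP => i; rewrite !ffunE scalerDr. Qed.

Lemma ftensZl c a f : ftens (c *: a) f = c *: ftens a f.
Proof. by apply/ffunP => i; rewrite !ffunE !scalerA mulrC. Qed.

Lemma ftensDr a f g : ftens a (f + g) = ftens a f + ftens a g.
Proof. by apply/ffunP => i; rewrite !ffunE scalerDl. Qed.

Lemma ftensZr c a f : ftens a (c *: f) = c *: ftens a f.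
Proof. by apply/ffunP => i; rewrite !ffunE scalerA. Qed.

Lemma ftens0l f : ftens 0 f = 0.
Proof. by apply/ffunP => i; rewrite !ffunE scaler0. Qed.

Lemma ftensNl a f : ftens (- a) f = - ftens a f.
Proof. by rewrite -scaleN1r ftensZl scaleN1r. Qed.

Lemma ftensNr a f : ftens a (- f) = - ftens a f.
Proof. by rewrite -scaleN1r ftensZr scaleN1r. Qed.

End TensorForm.

(** * Cyclic derivatives of words in linear forms *)

Section CyclicDerivation.
Variables (k : fieldType) (A : algType k) (I : finType) (gen : I -> A).
Local Notation form := {ffun I -> k^o}.
Implicit Types (f g : form) (w u v p q : seq form) (a b : A).

Definition lform i : form := locked [ffun i' => (i' == i)%:R].

Lemma lformE i i' : lform i i' = (i' == i)%:R.
Proof. by rewrite /lform -lock ffunE. Qed.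

Definition evf f : A := \sum_i f i *: gen i.
Definition evw w : A := \prod_(f <- w) evf f.

(* The value on [a (x) w_1...w_n] of the universal derivation of [A] composed
   with the trace: the sum of the [w_(i+1)...w_n a w_1...w_(i-1) (x) w_i]. *)
Fixpoint cycd a w : {ffun I -> A} :=
  if w is f :: w' then ftens (evw w' * a) f + cycd (a * evf f) w' else 0.

Lemma evf_lform i : evf (lform i) = gen i.
Proof.
rewrite /evf (bigD1 i) //= lformE eqxx scale1r big1 ?addr0 // => i' /negPf ne.
by rewrite lformE ne scale0r.
Qed.

Lemma evfD f g : evf (f + g) = evf f + evf g.
Proof. by rewrite /evf -big_split; apply: eq_bigr => l _; rewrite ffunE scalerDl. Qed.

Lemma evfZ c f : evf (c *: f) = c *: evf f.
Proof. by rewrite /evf scaler_sumr; apply: eq_bigr => l _; rewrite ffunE scalerA. Qed.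

Lemma evf0 : evf 0 = 0.
Proof. by rewrite /evf big1 // => l _; rewrite ffunE scale0r. Qed.

Lemma evfN f : evf (- f) = - evf f.
Proof. by rewrite -scaleN1r evfZ scaleN1r. Qed.

Lemma evw_nil : evw [::] = 1. Proof. exact: big_nil. Qed.

Lemma evw_cons f w : evw (f :: w) = evf f * evw w.
Proof. exact: big_cons. Qed.

Lemma evw_cat u v : evw (u ++ v) = evw u * evw v.
Proof. exact: big_cat. Qed.

Lemma evw1 f : evw [:: f] = evf f.
Proof. by rewrite evw_cons evw_nil mulr1. Qed.

Lemma cycdD a b w : cycd (a + b) w = cycd a w + cycd b w.
Proof.
elim: w a b => [|f w IH] a b /=; first by rewrite addr0.
by rewrite mulrDr mulrDl ftensDl IH addrACA.
Qed.

Lemma cycdZ c a w : cycd (c *: a) w = c *: cycd a w.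
Proof.
elim: w a => [|f w IH] a /=; first by rewrite scaler0.
by rewrite -scalerAr -scalerAl ftensZl IH scalerDr.
Qed.

(** The Leibniz rule: each factor is differentiated while the other one is carried around
    cyclically. *)
Lemma cycd_cat a u v : cycd a (u ++ v) = cycd (evw v * a) u + cycd (a * evw u) v.
Proof.
elim: u a => [|f u IH] a /=; first by rewrite evw_nil mulr1 add0r.
by rewrite IH evw_cat evw_cons !mulrA addrA.
Qed.

Lemma cycd_letterD a p f g q :
  cycd a (p ++ (f + g) :: q) = cycd a (p ++ f :: q) + cycd a (p ++ g :: q).
Proof.
rewrite !cycd_cat /= !evw_cons evfD mulrDl mulrDr cycdD mulrDl cycdD ftensDr.
by rewrite [in LHS](addrACA (ftens _ _)) [LHS]addrACA.
Qed.

Lemma cycd_rot u v : cycd 1 (u ++ v) = cycd 1 (v ++ u).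
Proof. by rewrite !cycd_cat !mulr1 !mul1r addrC. Qed.

Lemma cycd_letter0 a p q : cycd a (p ++ 0 :: q) = 0.
Proof.
have /eqP := cycd_letterD a p 0 0 q; rewrite addr0 -subr_eq0 opprD addNKr.
by rewrite oppr_eq0 => /eqP.
Qed.

Lemma cycd_letterN a p f q : cycd a (p ++ (- f) :: q) = - cycd a (p ++ f :: q).
Proof. by apply/eqP; rewrite -addr_eq0 -cycd_letterD addNr cycd_letter0. Qed.

Lemma cycd_nseq f n : cycd 1 (nseq n f) = ftens (evf f ^+ n.-1) f *+ n.
Proof.
(* The accumulator of [cycd] grows along the word, so the induction needs an arbitrary power in
   place of 1. *)
suff H m : cycd (evf f ^+ m) (nseq n f) = ftens (evf f ^+ (n + m).-1) f *+ n.
  by have := H 0%N; rewrite expr0 addn0.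
elim: n m => [|n IH] m //=; rewrite -exprSr IH addnS /= mulrS.
by congr (ftens _ _ + _); rewrite exprD /evw big_nseq -Monoid.iteropE.
Qed.

Lemma evw2 f g : evw [:: f; g] = evf f * evf g.
Proof. by rewrite evw_cons evw1. Qed.

Lemma cycd2 a f g : cycd a [:: f; g] = ftens (evf g * a) f + ftens (a * evf f) g.
Proof. by rewrite /= evw1 evw_nil mul1r addr0. Qed.

End CyclicDerivation.

(** * Combinatorics of the words of type (iv) *)

Section ThetaWords.
Implicit Types (w : seq letter) (c : seq bool).

(** The words of [theta_word], with the exponents in a sequence of pairs so that induction on blocks
    is possible. *)
Definition theta_blocks (s : seq (nat * nat)) : seq letter :=
  flatten [seq X :: nseq t.1 Y ++ nseq t.2 Z | t <- s].

Lemma theta_word_blocks p (n m : 'I_p -> nat) :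
  theta_word n m = theta_blocks [seq (n i, m i) | i <- enum 'I_p].
Proof.
rewrite /theta_blocks -map_comp /flatten foldrE big_map enumT.
by rewrite /theta_word [index_enum _]unlock.
Qed.

Lemma theta_blocks_word s : theta_blocks s =
  theta_word (fun i : 'I_(size s) => (nth (0, 0) s i).1)%N (fun i => (nth (0, 0) s i).2)%N.
Proof.
rewrite theta_word_blocks; congr theta_blocks.
apply: (@eq_from_nth _ (0, 0)%N); first by rewrite size_map size_enum_ord.
move=> i lti; rewrite (nth_map (Ordinal lti)) ?size_enum_ord //.
by rewrite nth_enum_ord //; case: (nth _ _ _).
Qed.

Definition pos_pair (t : nat * nat) : bool := (0 < t.1)%N && (0 < t.2)%N.

(** It fails exactly on [xx], [yx], [xz] and [zy], the two-letter words occurring in the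
    relations. *)
Definition theta_adj (l m : letter) : bool :=
  match l, m with
  | X, Y | Y, Y | Y, Z | Z, Z | Z, X => true
  | _, _ => false
  end.

Lemma theta_blocks_cycle s : all pos_pair s ->
  cycle theta_adj (theta_blocks s).
Proof.
have ny n w : path theta_adj Y (nseq n Y ++ w) = path theta_adj Y w.
  by elim: n => //= n ->.
have nz n w : path theta_adj Z (nseq n Z ++ w) = path theta_adj Z w.
  by elim: n => //= n ->.
have H l : all pos_pair s ->
    path theta_adj Z (theta_blocks s ++ l) = path theta_adj Z l.
  elim: s => //= -[[|a] [|b]] //= s IH hs.
  by rewrite /theta_blocks /= -!catA -/(theta_blocks s) ny /= nz IH.
move=> hs; case: s H hs => // -[a b] s H hs.
have := H [:: X] hs; rewrite /theta_blocks /= -cats1 => ->//.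
Qed.

(** In an infix [xy^jx] the final [x] would follow [x] or [y], which [theta_adj] forbids. *)
Lemma theta_adj_in_basis w : sorted theta_adj w -> in_basis w.
Proof.
move=> sw; have inf u : infix u w -> sorted theta_adj u.
  by move=> /infixP[p [q ew]]; move: sw; rewrite ew => /cat_sorted2[_ /cat_sorted2[]].
apply/and3P; split; try by apply/negP => /inf.
by apply/forallP => j; apply/negP => /inf /=; elim: (j : nat) => // n; case: n.
Qed.

(* Every [s = x + y] is replaced by [x] after [z] and by [y] after [s]. *)
Fixpoint szletters (prev : bool) c : seq letter :=
  if c is b :: c' then
    (if b then if prev then Y else X else Z) :: szletters b c' else [::].

Lemma size_szletters prev c : size (szletters prev c) = size c.
Proof. by elim: c prev => //= b c IH prev; rewrite IH. Qed.

Lemma szletters_rcons prev c b : szletters prev (rcons c b) =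
  rcons (szletters prev c) (if b then if last prev c then Y else X else Z).
Proof. by elim: c prev => //= d c IH prev; rewrite IH. Qed.

Lemma false_prefix c : exists b d, [/\ c = nseq b false ++ d, head true d,
  last false c = last false d & (size d <= size c)%N].
Proof.
elim: c => [|[] c [b [d [ec hd ld sd]]]]; first by exists 0%N, [::].
  by exists 0%N, (true :: c).
by exists b.+1, d; split=> //=; [rewrite -ec | exact: leqW].
Qed.

(** Strong induction on the length, removing a leading block [s^(a+1) z^(b+1)]. It turns into
    [x y^a z^(b+1)], a block of type (iv) if [a > 0], and a word containing [xz] if [a = 0]. *)
Lemma szletters_blocks c : last false c = false -> head true c ->
  (exists s, all pos_pair s /\ szletters false c = theta_blocks s) \/
  (exists u v, szletters false c = u ++ [:: X; Z] ++ v).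
Proof.
have [n] := ubnP (size c); elim: n c => // n IH c ltcn lc hc.
have ss c' : last false c' = false -> exists a d, c' = nseq a true ++ false :: d \/ c' = [::].
  elim: c' => [|[] c' IHc]; first by exists 0%N, [::]; right.
    move=> /= lc'; have [|a [d [e|e]]] := IHc; first by case: c' lc' {IHc}.
      by exists a.+1, d; left; rewrite e.
    by move: lc'; rewrite e.
  by exists 0%N, c'; left.
case: c ltcn lc hc => [|[] // c] ltcn lc _; first by left; exists [::].
have [|a [d [e|e]]] := ss c; [by case: c lc {ltcn} | | by move: lc; rewrite e].
have [b [f [ed hf lf sf]]] := false_prefix d.
have eL : szletters false (true :: c) = X :: nseq a Y ++ nseq b.+1 Z ++ szletters false f.
  rewrite e ed /=; congr (_ :: _); elim: (a) => [|a' IHa] /=; last by rewrite IHa.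
  by congr (_ :: _); elim: (b) => //= b' ->.
case: a e eL => [|a] e eL; first by right; exists [::], (nseq b Z ++ szletters false f).
have [|||[s [hs es]]|[u [v es]]] := IH f.
- move: ltcn; rewrite e /= size_cat /= size_nseq ltnS; move: sf; lia.
- by move: lc; rewrite e /= last_cat /= lf.
- exact: hf.
- left; exists ((a.+1, b.+1) :: s); split; first by rewrite /= hs.
  by rewrite eL es /theta_blocks /= -catA.
- right; exists (X :: nseq a.+1 Y ++ nseq b.+1 Z ++ u), v.
  by rewrite eL es /= -!catA /= -!catA.
Qed.

End ThetaWords.

(** * Cyclic derivatives of words in [s] and [z] *)

Section CyclicSpan.
Variable k : fieldType.

Definition sform : {ffun letter -> k^o} := lform k X + lform k Y.

(* The relations of the algebra, and a subspace [H] of [A (x) V_1] that contains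
   the image of [d_2] and the proposed basis. *)
Record cyclic_span (A : algType k) (gen : letter -> A)
    (H : {ffun letter -> A} -> Prop) : Prop := CyclicSpan {
  gen_sx : (gen X + gen Y) * gen X = 0;
  gen_xz : gen X * gen Z = 0;
  gen_zy : gen Z * gen Y = 0;
  spanD : forall u v, H u -> H v -> H (u + v);
  spanZ : forall c u, H u -> H (c *: u);
  span_sx : forall a, H (cycd gen a [:: sform; lform k X]);
  span_xz : forall a, H (cycd gen a [:: lform k X; lform k Z]);
  span_zy : forall a, H (cycd gen a [:: lform k Z; lform k Y]);
  span_alpha : forall n, H (ftens (gen X ^+ n) (lform k X));
  span_beta : forall n, H (ftens (gen Y ^+ n) (lform k Y));
  span_gamma : forall n, H (ftens (gen Z ^+ n) (lform k Z));
  span_theta : forall s, s != [::] -> all pos_pair s ->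
    H (cycd gen 1 [seq lform k l | l <- theta_blocks s])
}.

Variables (A : algType k) (gen : letter -> A) (H : {ffun letter -> A} -> Prop).
Hypothesis HS : cyclic_span gen H.
Local Notation form := {ffun letter -> k^o}.
Local Notation lform := (@lform k letter).
Local Notation evf := (@evf k A letter gen).
Local Notation evw := (@evw k A letter gen).
Local Notation cycd := (@cycd k A letter gen).
Implicit Types (f g : form) (u v p q : seq form) (a : A) (b : bool).
Implicit Types (c : seq bool) (w : seq letter).

Lemma span0 : H 0.
Proof.
rewrite -(scale0r (cycd 0 [:: lform Z; lform Y])).
exact: spanZ HS _ _ (span_zy HS _).
Qed.

Lemma spanN x : H x -> H (- x).
Proof. by rewrite -scaleN1r; exact: spanZ HS _ _. Qed.

Lemma spanMn x n : H x -> H (x *+ n).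
Proof. by rewrite -scaler_nat; exact: spanZ HS _ _. Qed.

Lemma evf_sform : evf sform = gen X + gen Y.
Proof. by rewrite evfD !evf_lform. Qed.

Lemma cycd_sform a p q : cycd a (p ++ sform :: q) =
  cycd a (p ++ lform X :: q) + cycd a (p ++ lform Y :: q).
Proof. exact: cycd_letterD. Qed.

(** Equality in [A] is included to obtain a congruence: by the Leibniz rule, the derivatives at
    letters around [u] depend on [u] only through its value. *)
Definition hequiv u v := evw u = evw v /\ forall a, H (cycd a u - cycd a v).

Lemma hequiv_refl u : hequiv u u.
Proof. by split=> // a; rewrite subrr; exact: span0. Qed.

Lemma hequiv_trans v u p : hequiv u v -> hequiv v p -> hequiv u p.
Proof.
move=> [e1 uv] [e2 vw]; split=> [|a]; first by rewrite e1.
by rewrite -(subrKA (cycd a v)); exact: (spanD HS).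
Qed.

Lemma hequiv_cat p q u v : hequiv u v -> hequiv (p ++ u ++ q) (p ++ v ++ q).
Proof.
move=> [uv huv]; split=> [|a]; first by rewrite !evw_cat uv.
rewrite !cycd_cat !evw_cat uv.
rewrite opprD addrACA subrr add0r opprD addrACA subrr addr0.
exact: huv.
Qed.

Lemma hequiv_ss_sy : hequiv [:: sform; sform] [:: sform; lform Y].
Proof.
split=> [|a].
  by rewrite !evw2 evf_lform evf_sform mulrDr (gen_sx HS) add0r.
by rewrite (cycd_sform a [:: sform] [::]) addrK; exact: span_sx HS _.
Qed.

Lemma hequiv_zs_zx : hequiv [:: lform Z; sform] [:: lform Z; lform X].
Proof.
split=> [|a]; first by rewrite !evw2 !evf_lform evf_sform mulrDr (gen_zy HS) addr0.
by rewrite (cycd_sform a [:: lform Z] [::]) addrAC subrr add0r; exact: span_zy HS _.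
Qed.

Lemma hequiv_xz_0z : hequiv [:: lform X; lform Z] [:: 0; lform Z].
Proof.
split=> [|a]; first by rewrite !evw2 !evf_lform (gen_xz HS) evf0 mul0r.
by rewrite (cycd_letter0 _ a [::]) subr0; exact: span_xz HS _.
Qed.

Lemma gen_yx : gen Y * gen X = - (gen X * gen X).
Proof. by apply/eqP; rewrite -addr_eq0 -mulrDl addrC (gen_sx HS). Qed.

Lemma hequiv_yx : hequiv [:: lform Y; lform X] [:: - lform X; lform X].
Proof.
split=> [|a]; first by rewrite !evw2 evfN !evf_lform mulNr gen_yx.
rewrite (cycd_letterN _ a [::]) opprK addrC -(cycd_sform a [::] [:: lform X]).
exact: span_sx HS _.
Qed.

Lemma hequiv_yNx : hequiv [:: lform Y; - lform X] [:: - lform X; - lform X].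
Proof.
have [_ h] := hequiv_yx; split=> [|a].
  by rewrite !evw2 !evfN !evf_lform mulrNN mulrN gen_yx opprK.
rewrite (cycd_letterN _ a [:: lform Y] _ [::]) (cycd_letterN _ a [:: - lform X] _ [::]).
by rewrite -opprD; apply: spanN; exact: h.
Qed.

Definition lforms w : seq form := [seq lform l | l <- w].

Lemma span_hequiv u v : hequiv u v -> H (cycd 1 v) -> H (cycd 1 u).
Proof.
move=> [_ uv] hv; rewrite -(subrK (cycd 1 v) (cycd 1 u)).
by apply: (spanD HS) => //; exact: uv.
Qed.

Definition szform (b : bool) : form := if b then sform else lform Z.
Definition szforms c := [seq szform b | b <- c].

(** The replacement runs from the right, so the left neighbour of the letter being replaced is still
    [s] or [z], as [hequiv_ss_sy] and [hequiv_zs_zx] require. *)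
Lemma hequiv_szletters prev c :
  hequiv (szform prev :: szforms c) (szform prev :: lforms (szletters prev c)).
Proof.
elim: c prev => [|b c IH] prev; first exact: hequiv_refl.
apply: (hequiv_trans (v := [:: szform prev, szform b & lforms (szletters b c)])).
  by have := hequiv_cat [:: szform prev] [::] (IH b); rewrite !cats0.
rewrite /=; set w := lforms _.
case: b @w => w; last exact: hequiv_refl.
case: prev; first exact: (hequiv_cat [::] w hequiv_ss_sy).
exact: (hequiv_cat [::] w hequiv_zs_zx).
Qed.

(** The last letter, a [z], is rotated to the front; it becomes the left neighbour that the argument
    [false] of [szletters] stands for. *)
Lemma span_szletters c : last true c = false ->
  H (cycd 1 (lforms (szletters false c))) -> H (cycd 1 (szforms c)).
Proof.
case/lastP: c => // c b; rewrite last_rcons => ->.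
rewrite szletters_rcons /szforms /lforms !map_rcons -!cats1.
rewrite -/(szforms c) -/(lforms _) cycd_rot [X in _ -> H X]cycd_rot.
exact: span_hequiv (hequiv_szletters false c).
Qed.

(** A word that is not of type (iv) contains [xz], which may be replaced by [0z]; its derivative
    then vanishes. *)
Lemma span_lforms c : c != [::] -> last false c = false -> head true c ->
  H (cycd 1 (lforms (szletters false c))).
Proof.
move=> c0 lc hc; have [[s [hs es]]|[u [v ->]]] := szletters_blocks lc hc.
  rewrite es; apply: (span_theta HS) => //; apply: contraNneq c0 => s0.
  by rewrite -size_eq0 -(size_szletters false) es s0.
rewrite /lforms !map_cat; apply: span_hequiv (hequiv_cat _ _ (hequiv_xz_0z)) _.
by rewrite /= cycd_letter0; exact: span0.
Qed.

Lemma hequiv_yyx n : hequiv (nseq n (lform Y) ++ [:: lform X])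
  (nseq n (- lform X) ++ [:: lform X]).
Proof.
elim: n => [|n IH]; first exact: hequiv_refl.
apply: (hequiv_trans (v := lform Y :: nseq n (- lform X) ++ [:: lform X])).
  by have := hequiv_cat [:: lform Y] [::] IH; rewrite !cats0.
case: n {IH} => [|n]; first exact: hequiv_yx.
exact: (hequiv_cat [::] (nseq n (- lform X) ++ [:: lform X]) hequiv_yNx).
Qed.

(** A positive power [s^(n+1)] is equivalent to [s y^n = x y^n + y^(n+1)]. The second word gives a
    multiple of a [beta1]; the first rotates to [y^n x], equivalent to [(-x)^n x], and gives a
    multiple of an [alpha1]. *)
Lemma span_nseq_s n : H (cycd 1 (szforms (nseq n true))).
Proof.
case: n => [|n]; first exact: span0.
apply: span_hequiv (hequiv_szletters true (nseq n true)) _.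
have -> : lforms (szletters true (nseq n true)) = nseq n (lform Y).
  by elim: n => //= n <-.
rewrite (cycd_sform 1 [::]); apply: (spanD HS); last first.
  rewrite -[_ ++ _]/(nseq n.+1 (lform Y)) cycd_nseq evf_lform.
  by apply: spanMn; exact: span_beta HS _.
rewrite -[_ ++ _]/([:: lform X] ++ nseq n (lform Y)) cycd_rot.
apply: span_hequiv (hequiv_yyx n) _.
rewrite -[cycd _ _]opprK -(cycd_letterN _ _ _ _ [::]); apply: spanN.
have -> : nseq n (- lform X) ++ [:: - lform X] = nseq n.+1 (- lform X).
  by elim: n => //= n ->.
rewrite cycd_nseq; apply: spanMn; rewrite /= ftensNr evfN evf_lform exprNn.
apply: spanN; rewrite -signr_odd; case: (odd n).
  by rewrite expr1 mulN1r ftensNl; apply: spanN; exact: span_alpha HS _.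
by rewrite expr0 mul1r; exact: span_alpha HS _.
Qed.

(** Powers of [s] and of [z] are treated directly. Any other word has a rotation that begins with
    [s] and ends with [z]: a [z] is brought to the front, then the whole leading run of [z] is moved
    to the end. *)
Lemma span_szforms c : H (cycd 1 (szforms c)).
Proof.
have [ct|] := boolP (all id c).
  have -> : c = nseq (size c) true by apply/all_pred1P; apply: sub_all ct => -[].
  exact: span_nseq_s.
have [cf _|] := boolP (all negb c).
  have -> : c = nseq (size c) false by apply/all_pred1P; apply: sub_all cf => -[].
  rewrite /szforms map_nseq cycd_nseq evf_lform; apply: spanMn.
  exact: span_gamma HS _.
rewrite -!has_predC => /hasP[t tc /negPn /= ht] /hasP[f fc /= hf].
have {}ht : t = true by []. have {}hf : f = false by case: (f) hf.
subst t f; have [i c' ec] := rot_to fc.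
have -> : cycd 1 (szforms c) = cycd 1 (szforms (rot i c)).
  by rewrite /szforms map_rot /rot cycd_rot cat_take_drop.
have [b [[|[] d] [ed // _ _ _]]] := false_prefix c'.
  by move: tc; rewrite -(mem_rot i) ec ed cats0 inE /= => /nseqP[].
rewrite ec ed /szforms -cat_cons map_cat cycd_rot -map_cat -/(szforms _).
have hl (x : bool) : last x ((true :: d) ++ false :: nseq b false) = false.
  by rewrite last_cat /=; elim: (b).
by apply: span_szletters; [exact: hl | apply: span_lforms; rewrite ?hl].
Qed.

End CyclicSpan.

(** * The action of the letters on the monomials [x^a c] *)

Section NormalAction.
Variable k : fieldType.
Local Notation M := {malg k[(nat * seq bool)%type]}.
Implicit Types (b : (nat * seq bool)%type) (c d : seq bool).

Definition starts_z c : bool := if c is false :: _ then true else false.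
Definition starts_sz c : bool := if c is [:: true, false & _] then true else false.
Definition ends_zs c : bool := starts_sz (rev c).

(* [(a, c)] stands for [x^a c] where [c] is a word in [s = x + y] (true) and
   [z] (false).  These words, restricted to the [normal] ones, form the monomial
   basis of [A] for the presentation [sx = xz = 0, zx = zs]. *)
Definition actS b : option (nat * seq bool) :=
  if b.1 == 0%N then Some (0%N, true :: b.2) else None.
Definition actX b : option (nat * seq bool) :=
  if starts_z b.2 then None else Some (b.1.+1, b.2).
(** The cases rest on [zx = zs]: without [x], the product vanishes on [sz...] because
    [zsz = zxz = 0]; with one [x], [zxc = zsc], which is 0 if [c] starts with [z]; beyond that,
    [zx^2 = zsx = 0]. *)
Definition actZ b : option (nat * seq bool) :=
  match b.1 with
  | 0 => if starts_sz b.2 then None else Some (0%N, false :: b.2)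
  | 1 => if starts_z b.2 then None else Some (0%N, [:: false, true & b.2])
  | _ => None
  end.

Definition lact (f : (nat * seq bool -> option (nat * seq bool))%type) : M -> M :=
  lext (fun b : (nat * seq bool)%type => if f b is Some b' then << b' >> else 0).
HB.instance Definition _ f := GRing.isLinear.Build k M M *:%R (lact f) (@lext_linear _ k M _).

Definition act (l : letter) (m : M) : M :=
  match l with
  | X => lact actX m
  | Y => lact actS m - lact actX m
  | Z => lact actZ m
  end.

Lemma lactU f b : lact f << b >> = if f b is Some b' then << b' >> else 0.
Proof. exact: lextU. Qed.

Lemma lact_linear f : linear (lact f).
Proof. exact: lext_linear. Qed.

Lemma lact0 f : lact f 0 = 0.
Proof. exact: linear0. Qed.

Lemma act_linear l : linear (act l).
Proof.
by case: l => c u v /=; rewrite !lact_linear // scalerBr opprD addrACA.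
Qed.

Lemma lact2_eq f g f' g' :
  (forall b, obind f (g b) = obind f' (g' b)) ->
  forall m, lact f (lact g m) = lact f' (lact g' m).
Proof.
move=> E m; have L h h' : linear (lact h \o lact h').
  by move=> c u v; rewrite /= !lact_linear.
apply: (malg_linear_eq (L f g) (L f' g')) => b /=; rewrite !lactU.
move: (E b); case: (g b) => [b1|]; case: (g' b) => [b2|] /=;
  rewrite ?lactU ?lact0 => e //.
- by rewrite e.
- by rewrite e.
- by rewrite -e.
Qed.

Lemma lact2_eq0 f g : (forall b, obind f (g b) = None) ->
  forall m, lact f (lact g m) = 0.
Proof.
move=> E m; have L : linear (lact f \o lact g).
  by move=> c u v; rewrite /= !lact_linear.
have L0 : linear (fun=> 0 : M) by move=> c ? ?; rewrite scaler0 addr0.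
apply: (malg_linear_eq L (L0 _)) => b /=; rewrite lactU.
by move: (E b); case: (g b) => [b1|] /=; rewrite ?lactU ?lact0 // => ->.
Qed.

Lemma act_xx m : act X (act X m) + act Y (act X m) = 0.
Proof.
rewrite /= addrC subrK; apply: lact2_eq0 => -[a c].
by rewrite /actX /=; case: (starts_z c).
Qed.

Lemma act_xz m : act X (act Z m) = 0.
Proof.
apply: lact2_eq0 => -[[|[|a]] c] //=.
  by rewrite /actZ /=; case: (starts_sz c).
by rewrite /actZ /=; case: (starts_z c).
Qed.

Lemma act_zy m : act Z (act Y m) = 0.
Proof.
rewrite /= (raddfB (lact actZ)) /=; apply/eqP; rewrite subr_eq0; apply/eqP.
apply: lact2_eq => -[[|a] c] /=; rewrite /actS /actX /actZ /=.
  by case: c => [|[]].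
by case: (starts_z c).
Qed.

Definition acts (w : seq letter) : M := foldr act << (0%N, [::]) >> w.

Lemma act0 l : act l 0 = 0.
Proof. by case: l; rewrite /= ?lact0 ?subrr. Qed.

Lemma actD l u v : act l (u + v) = act l u + act l v.
Proof. by have := act_linear l 1 u v; rewrite !scale1r. Qed.

(** This and the next two lemmas are the hypotheses of [wordA_lift_ex] for [acts]: the relations of
    [A] hold on [M]. *)
Lemma acts_xx p q : acts (p ++ [:: X; X] ++ q) + acts (p ++ [:: Y; X] ++ q) = 0.
Proof.
elim: p => [|l p IH]; first exact: act_xx.
by rewrite [acts _]/= [X in _ + X]/= -actD IH act0.
Qed.

Lemma acts_xz p q : acts (p ++ [:: X; Z] ++ q) = 0.
Proof. by elim: p => [|l p IH]; [exact: act_xz | rewrite /= IH act0]. Qed.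

Lemma acts_zy p q : acts (p ++ [:: Z; Y] ++ q) = 0.
Proof. by elim: p => [|l p IH]; [exact: act_zy | rewrite /= IH act0]. Qed.

Fixpoint avoids_zsz c : bool :=
  if c is e :: c' then avoids_zsz c' && (e || ~~ starts_sz c') else true.

Definition normal b : bool :=
  avoids_zsz b.2 && ((b.1 == 0%N) || ~~ starts_z b.2).

Lemma avoids_zsz_rcons_s c : avoids_zsz (rcons c true) = avoids_zsz c.
Proof. by elim: c => //= e c ->; case: c => [|[] [|[]]]. Qed.

Lemma avoids_zsz_rcons_z c :
  avoids_zsz (rcons c false) = avoids_zsz c && ~~ ends_zs c.
Proof.
elim: c => //= e c ->; rewrite /ends_zs rev_cons.
case: c => [|e1 [|e2 c]]; [by case: e | by case: e; case: e1 |].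
have -> : starts_sz (rcons (rev [:: e1, e2 & c]) e) = starts_sz (rev [:: e1, e2 & c]).
  have : (1 < size (rev [:: e1, e2 & c]))%N by rewrite size_rev.
  by case: (rev _) => [|f1 [|f2 r]].
by rewrite andbAC.
Qed.

Lemma ends_zsP c : reflect (exists d, c = d ++ [:: false; true]) (ends_zs c).
Proof.
apply: (iffP idP) => [|[d ->]]; last by rewrite /ends_zs rev_cat.
rewrite /ends_zs; case E: (rev c) => [|[] [|[] r]] // _.
by exists (rev r); rewrite -[c]revK E !rev_cons -!cats1 -catA.
Qed.

Lemma normal_actX b b' : normal b -> actX b = Some b' -> normal b'.
Proof.
case: b => a c; rewrite /normal /actX /=; case: ifP => // hz /andP[ac _] [<-] /=.
by rewrite ac hz.
Qed.

Lemma normal_actS b b' : normal b -> actS b = Some b' -> normal b'.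
Proof.
case: b => a c; rewrite /normal /actS /=; case: ifP => // _ /andP[ac _] [<-] /=.
by rewrite ac.
Qed.

Lemma normal_actZ b b' : normal b -> actZ b = Some b' -> normal b'.
Proof.
case: b => -[|[|a]] c; rewrite /normal /actZ //=; case: ifP => // hc /andP[ac _] [<-] /=.
  by rewrite ac hc.
by rewrite ac /=; case: c hc {ac} => [|[]].
Qed.

End NormalAction.

(** * Normal monomials as a basis of [A] *)

Section Defect.
Variables (k : fieldType) (A : algType k) (gen : letter -> A).
Variable H : {ffun letter -> A} -> Prop.
Hypothesis HS : cyclic_span gen H.
Hypothesis char0 : [pchar k] =i pred0.
Local Notation M := {malg k[(nat * seq bool)%type]}.
Variable Phi : {linear A -> M}.
Hypothesis Phi1 : Phi 1 = << (0%N, [::]) >>.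
Hypothesis PhiM : forall l a, Phi (gen l * a) = act l (Phi a).
Hypothesis wordP : forall P : A -> Prop, P 0 ->
  (forall c a b, P a -> P b -> P (c *: a + b)) ->
  (forall w, P (\prod_(l <- w) gen l)) -> forall a, P a.

Local Notation form := {ffun letter -> k^o}.
Local Notation lform := (@lform k letter).
Local Notation sform := (sform k).
Local Notation szform := (szform k).
Local Notation szforms := (szforms k).
Local Notation evf := (@evf k A letter gen).
Local Notation evw := (@evw k A letter gen).
Local Notation cycd := (@cycd k A letter gen).
Local Notation AV1 := {ffun letter -> A}.
Local Notation s := (gen X + gen Y).
Implicit Types (a : A) (b : (nat * seq bool)%type) (c d : seq bool) (u v : AV1).

Definition szev c : A := evw (szforms c).
Definition nev b : A := gen X ^+ b.1 * szev b.2.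

Lemma szev_nil : szev [::] = 1. Proof. exact: evw_nil. Qed.

Lemma szev_cons e c : szev (e :: c) = (if e then s else gen Z) * szev c.
Proof.
by rewrite /szev /= evw_cons; case: e; rewrite /= ?(evf_sform gen) ?evf_lform.
Qed.

Lemma szev_cat c d : szev (c ++ d) = szev c * szev d.
Proof. by rewrite /szev /szforms map_cat evw_cat. Qed.

Lemma szev_rcons c e : szev (rcons c e) = szev c * (if e then s else gen Z).
Proof. by rewrite -cats1 szev_cat szev_cons szev_nil mulr1. Qed.

Lemma gen_zs : gen Z * s = gen Z * gen X.
Proof. by rewrite mulrDr (gen_zy HS) addr0. Qed.

Lemma nev_actS b : normal b -> s * nev b = oapp nev 0 (actS b).
Proof.
case: b => -[|a] c _; rewrite /nev /actS /=.
  by rewrite !expr0 !mul1r szev_cons.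
by rewrite exprS !mulrA (gen_sx HS) !mul0r.
Qed.

Lemma nev_actX b : normal b -> gen X * nev b = oapp nev 0 (actX b).
Proof.
case: b => a c; rewrite /normal /nev /actX /= => /andP[_].
case: c => [|[] c] /=; rewrite ?orbF; try by rewrite exprS mulrA.
by move/eqP->; rewrite expr0 mul1r szev_cons mulrA (gen_xz HS) mul0r.
Qed.

Lemma szev_zsz c : starts_sz c -> gen Z * szev c = 0.
Proof.
case: c => [|[] [|[] c]] // _; rewrite !szev_cons !mulrA gen_zs.
by rewrite -(mulrA (gen Z)) (gen_xz HS) mulr0 mul0r.
Qed.

Lemma nev_actZ b : normal b -> gen Z * nev b = oapp nev 0 (actZ b).
Proof.
case: b => -[|[|a]] c; rewrite /normal /nev /actZ /= => /andP[_ hc].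
- rewrite expr0 mul1r; have [sc|_] := boolP (starts_sz c); first exact: szev_zsz.
  by rewrite /= expr0 mul1r szev_cons.
- by rewrite (negPf hc) /= expr0 expr1 mul1r !szev_cons !mulrA gen_zs.
- rewrite !exprS !mulrA -gen_zs -(mulrA (gen Z)) (gen_sx HS).
  by rewrite mulr0 !mul0r.
Qed.

(** The linear span of the normal monomials, encoded as the induction principle for which it
    serves. *)
Definition nspan a := forall P : A -> Prop, P 0 ->
  (forall (e : k) a1 a2, P a1 -> P a2 -> P (e *: a1 + a2)) ->
  (forall b, normal b -> P (nev b)) -> P a.

Lemma nspan0 : nspan 0. Proof. by move=> P. Qed.

Lemma nspanP (e : k) a1 a2 : nspan a1 -> nspan a2 -> nspan (e *: a1 + a2).
Proof. by move=> h1 h2 P P0 Pc Pn; apply: (Pc); [exact: h1 | exact: h2]. Qed.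

Lemma nspan_nev b : normal b -> nspan (nev b).
Proof. by move=> nb P _ _ hP; exact: hP. Qed.

Lemma nspan_mul (a0 : A) f :
  (forall b, normal b -> a0 * nev b = oapp nev 0 (f b)) ->
  (forall b b', normal b -> f b = Some b' -> normal b') ->
  forall a, nspan a -> nspan (a0 * a).
Proof.
move=> hf hn a ha; apply: (ha (fun a => nspan (a0 * a))).
- by rewrite mulr0; exact: nspan0.
- by move=> c a1 a2 h1 h2; rewrite mulrDr -scalerAr; exact: nspanP.
- move=> b nb; rewrite hf //; case E: (f b) => [b'|] /=; last exact: nspan0.
  exact: nspan_nev (hn _ _ nb E).
Qed.

(** Left multiplication by [x], [s] or [z] sends a normal monomial to a normal monomial or to 0, and
    [y = s - x]. *)
Lemma nspan_all a : nspan a.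
Proof.
apply: (wordP (P := nspan)); [exact: nspan0 | exact: nspanP | elim=> [|l w IH]].
  by rewrite big_nil; have := @nspan_nev (0%N, [::]) isT; rewrite /nev szev_nil mulr1.
rewrite big_cons; set a' := \prod_(_ <- _) _ in IH *.
have hx := nspan_mul nev_actX normal_actX IH.
have hs := nspan_mul nev_actS normal_actS IH.
have hz := nspan_mul nev_actZ normal_actZ IH.
case: l => //; have -> : gen Y * a' = (-1) *: (gen X * a') + s * a'.
  by rewrite scaleN1r mulrDl addKr.
exact: nspanP.
Qed.

Lemma Phi_s a : Phi (s * a) = lact actS (Phi a).
Proof. by rewrite mulrDl linearD !PhiM /= addrC subrK. Qed.

(** Hence the normal monomials are independent, and [Phi] computes coordinates on them. *)
Lemma Phi_nev b : normal b -> Phi (nev b) = << b >>.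
Proof.
case: b => n c; elim: n => [|n IH].
  elim: c => [|e c IH]; first by rewrite /nev szev_nil mulr1 Phi1.
  rewrite /normal /= andbT => /andP[ac hc].
  have {}IH : Phi (nev (0%N, c)) = << (0%N, c) >> by apply: IH; rewrite /normal ac.
  move: IH; rewrite /nev !expr0 !mul1r szev_cons => IH.
  case: e hc => /= hc; first by rewrite Phi_s IH lactU.
  by rewrite PhiM IH /= lactU /actZ /= (negPf hc).
rewrite /normal /= => /andP[ac hc]; rewrite /nev exprS -mulrA PhiM.
by rewrite -[_ ^+ n * _]/(nev (n, c)) IH /normal ?ac ?hc ?orbT //= lactU /actX /= (negPf hc).
Qed.

Fixpoint wcycd a n (w : seq form) : AV1 :=
  if w is f :: w' then ftens (evw w' * a) f *+ n + wcycd (a * evf f) n.+1 w' else 0.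

Lemma wcycdS a n w : wcycd a n.+1 w = wcycd a n w + cycd a w.
Proof.
elim: w a n => [|f w IH] a n /=; first by rewrite addr0.
by rewrite IH mulrSr -!addrA; congr (_ + _); rewrite addrCA.
Qed.

Lemma wcycd_rcons a n w f :
  wcycd a n (rcons w f) = wcycd (evf f * a) n w + ftens (a * evw w) f *+ (n + size w).
Proof.
elim: w a n => [|g w IH] a n /=; first by rewrite evw_nil mul1r mulr1 addr0 add0r addn0.
by rewrite IH -cats1 evw_cat evw1 evw_cons !mulrA addSnnS addrA.
Qed.

(** Moving [f] from the front to the end raises its weight from 0 to [size w] and lowers every other
    weight by 1. *)
Lemma wcycd_rot f w : wcycd 1 0 (rcons w f) - wcycd 1 0 (f :: w) =
  ftens (evw w) f *+ (size w).+1 - cycd 1 (rcons w f).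
Proof.
rewrite wcycd_rcons /= mulr0n add0r mul1r mulr1 add0n wcycdS.
rewrite -cats1 cycd_cat evw1 /= mulr1 evw_nil !mul1r addr0 opprD addrACA subrr add0r.
by rewrite mulrSr opprD addrACA subrr addr0 addrC.
Qed.

(** * Construction of the map [T] *)

Definition chop c := take (size c).-1 c.

Lemma chop_rcons c e : chop (rcons c e) = c.
Proof. by rewrite /chop size_rcons /= -cats1 take_size_cat. Qed.

Definition bad c := starts_sz c && ~~ last true c.

(** For a bad [c] its image under [d_1] is [c]: the commutator of [chop c] with [z] is [c], because
    [z] times [chop c] begins with [zsz]. Only for [c = sz] is it [sz - zs]; subtracting [x (x) z],
    with commutator [xz - zx = - zs], corrects this. *)
Definition bad_prim c : AV1 := ftens (szev (chop c)) (lform Z) -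
  (if c == [:: true; false] then ftens (gen X) (lform Z) else 0).

(* A primitive for the commutators among words in [s] and [z]. A word [sz...z]
   whose last letter cannot be moved to the front, because [zsz = 0], is the end of
   its rotation chain. *)
Definition prim0 c : AV1 :=
  if bad c then bad_prim c
  else if last false c && bad (true :: chop c)
  then ftens (szev (chop c)) sform + bad_prim (true :: chop c)
  else (size c)%:R^-1 *: wcycd 1 0 (szforms c).

(** The exponent of [x] is [n.+1] in the first branch. The last letter of [c] is split off; moved to
    the front it is killed by [sx = 0] or [zx^2 = 0], except for [z] before a single [x], where
    [zx = zs] and [prim0] takes over. A power of [x] receives 0. *)
Definition prim b : AV1 :=
  if b.1 is n.+1 then
    if b.2 == [::] then 0
    else ftens (nev (b.1, chop b.2)) (szform (last true b.2)) +
      (if (n == 0%N) && ~~ last true b.2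
       then prim0 [:: false, true & chop b.2] else 0)
  else prim0 b.2.

(** This is the map [T]. *)
Definition homot a : AV1 := lext prim (Phi a).

Lemma homot_linear : linear homot.
Proof. by move=> c a1 a2; rewrite /homot linearP lext_linear. Qed.

Lemma homot_nev b : normal b -> homot (nev b) = prim b.
Proof. by move=> nb; rewrite /homot Phi_nev // lextU. Qed.

(** * The defect [v - T (d_1 v)] *)

Definition bdry (v : AV1) : A := \sum_l (v l * gen l - gen l * v l).

Lemma bdry_linear : linear bdry.
Proof.
move=> c u v; rewrite /bdry scaler_sumr -big_split; apply: eq_bigr => l _ /=.
by rewrite !ffunE mulrDl mulrDr -scalerAl -scalerAr scalerBr opprD addrACA.
Qed.

Lemma bdry_ftens a f : bdry (ftens a f) = a * evf f - evf f * a.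
Proof.
rewrite /bdry /evf mulr_sumr mulr_suml -sumrB; apply: eq_bigr => l _.
by rewrite ffunE -!scalerAl -!scalerAr.
Qed.

Lemma bdryD u v : bdry (u + v) = bdry u + bdry v.
Proof. by have := bdry_linear 1 u v; rewrite !scale1r. Qed.

Lemma bdry0 : bdry 0 = 0.
Proof.
have := bdryD 0 0; rewrite addr0 => /esym/eqP.
by rewrite addrC -subr_eq0 addrK => /eqP.
Qed.

Lemma bdry_cycd a w : bdry (cycd a w) = a * evw w - evw w * a.
Proof.
elim: w a => [|f w IH] a /=; first by rewrite evw_nil mulr1 mul1r subrr bdry0.
rewrite bdryD bdry_ftens IH evw_cons !mulrA addrC.
by rewrite addrA subrK.
Qed.

(** A linear condition that holds for the cycles in [H], in particular for the images of the
    relations. These allow passing from one tensor to another until [T] can be computed. *)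
Definition good v := H (v - homot (bdry v)).

Lemma good_linear (e : k) u v : good u -> good v -> good (e *: u + v).
Proof.
rewrite /good bdry_linear homot_linear opprD addrACA -scalerBr => hu hv.
by apply: (spanD HS) => //; exact: (spanZ HS).
Qed.

Lemma homot0 : homot 0 = 0.
Proof. by have := homot_linear (-1) 0 0; rewrite scaler0 addr0 scaleN1r addNr. Qed.

Lemma good_cycle v : H v -> bdry v = 0 -> good v.
Proof. by move=> hv v0; rewrite /good v0 homot0 subr0. Qed.

Lemma good0 : good 0.
Proof. by apply: good_cycle; [exact: span0 HS | exact: bdry0]. Qed.

Lemma goodD u v : good u -> good v -> good (u + v).
Proof. by move=> hu hv; rewrite -[u]scale1r; exact: good_linear. Qed.

Lemma goodZ (e : k) v : good v -> good (e *: v).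
Proof. by move=> hv; rewrite -[_ *: _]addr0; apply: good_linear => //; exact: good0. Qed.

Lemma goodN v : good v -> good (- v).
Proof. by rewrite -scaleN1r; exact: goodZ. Qed.

Lemma good_swap u v : good (u + v) -> good u -> good v.
Proof. by move=> huv hu; rewrite -[v](addKr u); apply: goodD => //; exact: goodN. Qed.

Lemma good_rel a f g : H (cycd a [:: f; g]) -> evf f * evf g = 0 ->
  good (ftens (evf g * a) f + ftens (a * evf f) g).
Proof.
rewrite -cycd2 => h fg; apply: good_cycle => //.
by rewrite bdry_cycd evw2 fg mulr0 mul0r subrr.
Qed.

Lemma good_nspan (f : form) a :
  (forall b, normal b -> good (ftens (nev b) f)) -> good (ftens a f).
Proof.
move=> hb; apply: (nspan_all a (P := fun a => good (ftens a f))) => //.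
  by rewrite ftens0l; exact: good0.
by move=> c a1 a2 h1 h2; rewrite ftensDl ftensZl; exact: good_linear.
Qed.

Lemma natS_neq0 n : n.+1%:R != 0 :> k.
Proof. by have /pcharf0P -> := char0. Qed.

Lemma homotB a1 a2 : homot (a1 - a2) = homot a1 - homot a2.
Proof.
have := homot_linear (-1) a2 a1; rewrite !scaleN1r => e.
by rewrite [a1 - a2]addrC e addrC.
Qed.

Lemma nev0 c : nev (0%N, c) = szev c.
Proof. by rewrite /nev expr0 mul1r. Qed.

Lemma evf_szform e : evf (szform e) = if e then s else gen Z.
Proof. by case: e; rewrite /= ?(evf_sform gen) ?evf_lform. Qed.

Lemma prim0_rot c e :
  (size c).+1%:R *: (ftens (szev c) (szform e)
     - ((size c).+1%:R^-1 *: wcycd 1 0 (szforms (rcons c e))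
     - (size c).+1%:R^-1 *: wcycd 1 0 (szforms (e :: c)))) = cycd 1 (szforms (rcons c e)).
Proof.
rewrite -scalerBr [LHS]scalerBr scalerA divff ?natS_neq0 // scale1r scaler_nat.
rewrite /szforms map_rcons -/(szforms _) (wcycd_rot (szform e)) size_map.
by rewrite opprB addrC subrK.
Qed.

(** This is [wcycd_rot] divided by the length of the word, which is invertible in characteristic
    0. *)
Lemma span_rot c e : H (ftens (szev c) (szform e)
     - ((size c).+1%:R^-1 *: wcycd 1 0 (szforms (rcons c e))
     - (size c).+1%:R^-1 *: wcycd 1 0 (szforms (e :: c)))).
Proof.
rewrite -[X in H X](scalerK (natS_neq0 (size c))) prim0_rot.
by apply: (spanZ HS); exact: span_szforms HS _.
Qed.

Lemma bad_rcons_s c : bad (rcons c true) = false.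
Proof. by rewrite /bad last_rcons andbF. Qed.

(** The commutator is [cs - sc]. If [sc] is bad, the values of [prim0] differ by exactly [c (x) s];
    otherwise both are weighted derivatives and [span_rot] applies. *)
Lemma good_s0 c : avoids_zsz c -> good (ftens (szev c) sform).
Proof.
move=> ac; rewrite /good bdry_ftens (evf_szform true) -(szev_rcons c true) -(szev_cons true c).
rewrite homotB -!nev0 !homot_nev /normal /= ?avoids_zsz_rcons_s ?ac //.
rewrite nev0 /prim /= /prim0 bad_rcons_s last_rcons chop_rcons /=.
have [_|nb] := ifP; first by rewrite addrK subrr; exact: span0 HS.
(* The second case of [prim0] cannot occur for [sc]: it would need a bad word that starts with [ss]
   or equals [s]. *)
case: ifP => [/andP[lc]|_]; last by rewrite size_rcons; exact: span_rot c true.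
have {lc} : c = [::] \/ exists d, c = rcons d true.
  by case/lastP: c lc {ac nb} => [|d e]; [left | rewrite /= last_rcons => ->; right; exists d].
by case=> [->|[d ->]] //; rewrite -rcons_cons chop_rcons.
Qed.

Lemma nev_rcons n c e : nev (n, c) * (if e then s else gen Z) = nev (n, rcons c e).
Proof. by rewrite /nev -mulrA /= szev_rcons. Qed.

Lemma rcons_eq_nil (T : eqType) (t : seq T) e : (rcons t e == [::]) = false.
Proof. by case: t. Qed.

Lemma good_s a : good (ftens a sform).
Proof.
apply: good_nspan => -[[|n] c]; rewrite /normal /=.
  by rewrite nev0 => /andP[ac _]; exact: good_s0.
move=> /andP[ac hc]; rewrite /good bdry_ftens (evf_szform true) (nev_rcons _ _ true).
have -> : s * nev (n.+1, c) = 0 by rewrite /nev exprS !mulrA (gen_sx HS) !mul0r.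
rewrite subr0 homot_nev; last first.
  by rewrite /normal /= avoids_zsz_rcons_s ac /=; case: c hc {ac}.
rewrite /prim /= rcons_eq_nil chop_rcons !last_rcons andbF addr0 subrr.
exact: span0 HS.
Qed.

Lemma prim0_zs : prim0 [:: false; true] =
  ftens (gen Z) sform + prim0 [:: true; false].
Proof. by rewrite /prim0 /= /chop /= szev_cons szev_nil mulr1. Qed.

Lemma prim0_sz : prim0 [:: true; false] =
  ftens s (lform Z) - ftens (gen X) (lform Z).
Proof. by rewrite /prim0 /= /bad_prim /= /chop /= szev_cons szev_nil mulr1. Qed.

Lemma span_cycd_zs : H (ftens s (lform Z) + ftens (gen Z) sform).
Proof.
have := span_szforms HS [:: false; true].
rewrite -[szforms _]/[:: lform Z; sform].
by rewrite cycd2 mulr1 mul1r (evf_sform gen) evf_lform.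
Qed.

(** For [x (x) z] the defect is the cyclic derivative of [zs]. A higher power is traded, through the
    relation [xz], for a tensor with first factor [z x^(n+1)]; this is 0 or [zs], and [zs (x) x] is
    traded for [xz (x) s] through [sx]. *)
Lemma good_Zx_Z n : good (ftens (gen X ^+ n.+1) (lform Z)).
Proof.
case: n => [|n].
  rewrite /good bdry_ftens evf_lform expr1 (gen_xz HS) sub0r -gen_zs.
  have -> : - (gen Z * s) = 0 - nev (0%N, [:: false; true]).
    by rewrite nev0 !szev_cons szev_nil mulr1 sub0r.
  rewrite homotB homot0 sub0r homot_nev // opprK /prim /= prim0_zs prim0_sz.
  by rewrite addrC -addrA subrK addrC; exact: span_cycd_zs.
have r := good_rel (span_xz HS (gen X ^+ n.+1)).
move: r; rewrite !evf_lform => r.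
have {}r := r (gen_xz HS); rewrite -exprSr in r.
apply: good_swap r _; rewrite exprS mulrA -gen_zs.
case: n => [|n]; last first.
  rewrite exprS !mulrA -(mulrA (gen Z)) (gen_sx HS) mulr0 mul0r ftens0l.
  exact: good0.
rewrite expr0 mulr1.
have r := good_rel (span_sx HS (gen Z)).
move: r; rewrite (evf_sform gen) !evf_lform => r; have {}r := r (gen_sx HS).
by apply: good_swap r _; exact: good_s.
Qed.

(** If [c] starts with [sz], then [zc = 0], [cz] is bad and [prim0] returns [c (x) z]. For [c = s]
    the defect is the cyclic derivative of [zs]. Otherwise [span_rot] applies. *)
Lemma good_Z0 c : avoids_zsz c -> ~~ ends_zs c -> good (ftens (szev c) (lform Z)).
Proof.
move=> ac ec; rewrite /good bdry_ftens evf_lform -(szev_rcons c false) homotB.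
rewrite -(nev0 (rcons c false)) homot_nev; last by rewrite /normal /= avoids_zsz_rcons_z ac ec.
rewrite {1}/prim /=; have [sc|sc] := boolP (starts_sz c).
  rewrite (szev_zsz sc) homot0 subr0 /prim0.
  have -> : bad (rcons c false) = true.
    by rewrite /bad last_rcons andbT; case: c sc {ac ec} => [|[] [|[]]].
  rewrite /bad_prim chop_rcons.
  have -> : (rcons c false == [:: true; false]) = false.
    by case: c sc {ac ec} => [|[] [|[] [|]]].
  by rewrite subr0 subrr; exact: span0 HS.
rewrite -(szev_cons false c) -(nev0 (false :: c)) homot_nev /normal /= ?ac ?sc //.
rewrite /prim /=; have [->|cs] := eqVneq c [:: true].
  rewrite /= prim0_zs szev_cons szev_nil mulr1 opprB addrK.
  exact: span_cycd_zs.
have nb : bad (rcons c false) = false.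
  by rewrite /bad last_rcons andbT; case: c sc cs {ac ec} => [|[] [|[]]].
rewrite /prim0 nb last_rcons /= size_rcons.
(* The second case of [prim0] for [zc] would force [c = s] or [c] to end in [zs]; both are
   excluded. *)
case: ifP => [/andP[lc]|_]; last exact: span_rot c false.
case/lastP: c ec sc cs lc {ac nb} => // d e ec sc cs.
rewrite last_rcons; case: e ec sc cs => // ec sc cs _.
rewrite -rcons_cons chop_rcons; case/lastP: d ec sc cs => [_ _ /eqP //|d e' ec _ _].
rewrite /bad /= last_rcons => /negPf e'0.
by move: ec; rewrite /ends_zs !rev_rcons e'0.
Qed.

Lemma good_Zx n c : normal (n.+1, c) -> c != [::] -> ~~ ends_zs c ->
  good (ftens (nev (n.+1, c)) (lform Z)).
Proof.
move=> nc c0 ec; have [ac hc] : avoids_zsz c /\ ~~ starts_z c.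
  by move: nc; rewrite /normal /= => /andP.
rewrite /good bdry_ftens evf_lform (nev_rcons _ _ false) nev_actZ // homotB.
rewrite homot_nev; last first.
  by rewrite /normal /= avoids_zsz_rcons_z ac ec /=; case: c hc c0 {nc ac ec}.
rewrite /prim /= rcons_eq_nil chop_rcons !last_rcons /= andbT.
case: n nc => [|n] nc; rewrite /actZ /=; last first.
  by rewrite homot0 subr0 addr0 subrr; exact: span0 HS.
rewrite (negPf hc) /= homot_nev; last first.
  by rewrite /normal /= ac /=; case: c hc {nc c0 ac ec} => [|[]].
by rewrite addrK subrr; exact: span0 HS.
Qed.

Lemma good_Z_normal n c : normal (n, c) -> ~~ ends_zs c ->
  good (ftens (nev (n, c)) (lform Z)).
Proof.
case: n => [|n] nc ec; first by rewrite nev0; apply: good_Z0 => //; case/andP: nc.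
have [->|c0] := eqVneq c [::]; last exact: good_Zx.
by rewrite /nev szev_nil mulr1; exact: good_Zx_Z.
Qed.

Lemma good_relXZ a : good (ftens (gen Z * a) (lform X) + ftens (a * gen X) (lform Z)).
Proof.
have := good_rel (span_xz HS a); rewrite !evf_lform; apply; exact: gen_xz HS.
Qed.

Lemma good_relZY a : good (ftens (gen Y * a) (lform Z) + ftens (a * gen Z) (lform Y)).
Proof.
have := good_rel (span_zy HS a); rewrite !evf_lform; apply; exact: gen_zy HS.
Qed.

Lemma good_relsX a : good (ftens (gen X * a) sform + ftens (a * s) (lform X)).
Proof.
have := good_rel (span_sx HS a); rewrite (evf_sform gen) !evf_lform; apply; exact: gen_sx HS.
Qed.

Lemma good_relX a : good (ftens a (lform X) + ftens a (lform Y)).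
Proof. by rewrite -ftensDr; exact: good_s. Qed.

Lemma ends_zs_cat c d : (1 < size d)%N -> ends_zs (c ++ d) = ends_zs d.
Proof.
by rewrite /ends_zs rev_cat -(size_rev d); case: (rev d) => [|e [|e' d']].
Qed.

(* [b zs (x) z = b zx (x) z] is homologous to [- zbz (x) s - szb (x) z]. *)
Lemma good_Z_zs n d : normal (n, rcons (rcons d false) true) ->
  good (ftens (nev (n, rcons (rcons d false) true)) (lform Z)).
Proof.
rewrite /normal /= avoids_zsz_rcons_s avoids_zsz_rcons_z => /andP[/andP[ad ed] hd].
rewrite -(nev_rcons _ _ true) -(nev_rcons _ _ false) /= -mulrA gen_zs mulrA.
set b := nev (n, d); apply: good_swap (good_relXZ (b * gen Z)) _.
have nd : normal (n, d).
  by rewrite /normal ad; case: d hd {ad ed b} => [|[]] //=; rewrite orbT.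
(* For [b = s] the word [szb] would end in [zs] again, but then [zbz = zsz = 0]. *)
have [ed1|d1] := eqVneq (n, d) (0%N, [:: true]).
  rewrite /b ed1 nev0 szev_cons szev_nil mulr1 mulrA gen_zs -mulrA (gen_xz HS) mulr0.
  by rewrite ftens0l; exact: good0.
apply: (good_swap (u := ftens (gen Z * (b * gen Z)) (lform Y))).
  by rewrite addrC; exact: good_relX.
rewrite mulrA; apply: good_swap (good_relZY (gen Z * b)) _.
have -> : gen Y * (gen Z * b) = s * (gen Z * b).
  by rewrite mulrDl [gen X * _]mulrA (gen_xz HS) mul0r add0r.
rewrite /b nev_actZ //; case: n b hd nd d1 => [|[|n]] b hd nd d1; rewrite /actZ /=; last first.
- by rewrite mulr0 ftens0l; exact: good0.
- case: ifP => [_|hz] /=; first by rewrite mulr0 ftens0l; exact: good0.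
  rewrite nev0 -(szev_cons true); apply: good_Z0 => /=.
    by rewrite ad /=; case: d hz {b ad ed hd nd d1} => [|[]].
  case: d hd ed {b ad nd d1 hz} => [//|e [|e' d]] _ ed; first by case: e {ed}.
  by rewrite -[[:: true, false, true & _]]/([:: true; false; true] ++ _) ends_zs_cat.
- case: ifP => [_|hz] /=; first by rewrite mulr0 ftens0l; exact: good0.
  rewrite nev0 -(szev_cons true); apply: good_Z0 => /=; first by rewrite ad hz.
  case: d d1 ed {b ad nd hd hz} => [//|e [|e' d]] d1 ed; first by case: e d1 {ed}.
  by rewrite -[[:: true, false & _]]/([:: true; false] ++ _) ends_zs_cat.
Qed.

Lemma good_Z a : good (ftens a (lform Z)).
Proof.
apply: good_nspan => -[n c] nc; have [ec|] := boolP (ends_zs c); last exact: good_Z_normal.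
have /ends_zsP[d ed] := ec.
have {}ed : c = rcons (rcons d false) true by rewrite ed -!cats1 -catA.
by rewrite ed in nc *; exact: good_Z_zs.
Qed.

(** By the last letter of the monomial: a power of [x] gives an [alpha1]; after [s] the relation
    [sx] leads to a tensor with [s]; after [z] the second factor is changed to [y], and [zy] leads
    to a tensor with [z]. *)
Lemma good_X a : good (ftens a (lform X)).
Proof.
apply: good_nspan => -[n c] _; case/lastP: c => [|d [|]].
- rewrite /nev szev_nil mulr1; apply: good_cycle; first exact: span_alpha HS _.
  by rewrite bdry_ftens evf_lform /= -exprSr -exprS subrr.
- by rewrite -(nev_rcons _ _ true); apply: good_swap (good_relsX _) (good_s _).
rewrite -(nev_rcons _ _ false) /=; set q := nev _.
apply: (good_swap (u := ftens (q * gen Z) (lform Y))).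
  by rewrite addrC; exact: good_relX.
exact: good_swap (good_relZY q) (good_Z _).
Qed.

Lemma good_Y a : good (ftens a (lform Y)).
Proof. exact: good_swap (good_relX a) (good_X a). Qed.

Lemma ftens_decomp v : v = \sum_l ftens (v l) (lform l).
Proof.
apply/ffunP => l; rewrite sum_ffunE (bigD1 l) //= ffunE lformE eqxx scale1r.
rewrite big1 ?addr0 // => l' /negPf ne; rewrite ffunE lformE eq_sym ne scale0r //.
Qed.

Lemma span_cycle v : bdry v = 0 -> H v.
Proof.
move=> v0; suff : good v by rewrite /good v0 homot0 subr0.
rewrite [v]ftens_decomp; elim/big_rec: _ => [|l u _ hu]; first exact: good0.
apply: goodD => //; case: l; [exact: good_X | exact: good_Y | exact: good_Z].
Qed.

End Defect.

(** * A criterion for a basis of homology *)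

Section HomologyBasis.
Variables (K : fieldType) (U V W : lmodType K).
Variables (f : {linear U -> V}) (g : {linear V -> W}) (E : V -> Prop).

Inductive bspan : V -> Prop :=
| Bspan_bdry u : bspan (f u)
| Bspan_elt c e v of E e & bspan v : bspan (c *: e + v).

Lemma bspan0 : bspan 0.
Proof. by rewrite -(linear0 f); exact: Bspan_bdry. Qed.

Lemma bspanD v w : bspan v -> bspan w -> bspan (v + w).
Proof.
move=> hv hw; elim: hv => [u|c e v' he _ IH]; last by rewrite -addrA; exact: Bspan_elt.
elim: hw => [u'|c e v' he _ IH]; first by rewrite -linearD; exact: Bspan_bdry.
by rewrite addrCA; exact: Bspan_elt.
Qed.

Lemma bspanZ c v : bspan v -> bspan (c *: v).
Proof.
elim=> [u|c' e v' he _ IH]; first by rewrite -linearZ; exact: Bspan_bdry.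
by rewrite scalerDr scalerA; exact: Bspan_elt.
Qed.

Lemma bspan_elt e : E e -> bspan e.
Proof. by move=> he; rewrite -[e]addr0 -[e]scale1r; apply: Bspan_elt he bspan0. Qed.

Hypothesis Ecycle : forall e, E e -> g e = 0.
Hypothesis spanE : forall v, g v = 0 -> bspan v.
Hypothesis indepE : forall (s : seq (Defs.cycle g)) (c : Defs.cycle g -> K) u, uniq s ->
  {in s, forall z, E (val z)} -> f u = \sum_(z <- s) c z *: val z ->
  {in s, forall z, c z = 0}.

Local Notation bnd := (@boundary K U V W f g).
Local Notation cls := (@hclass K U V W f g).

Lemma hclass_linear : linear cls.
Proof. exact: lquot_proj_linear. Qed.

Lemma hclass_eq0 z : cls z = 0 <-> exists u, f u = val z.
Proof.
have e0 : cls 0 = 0 by have := hclass_linear (-1) 0 0; rewrite scaler0 addr0 scaleN1r addNr.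
have E0 : (cls z == cls 0) = (z \in bnd).
  by rewrite -[in RHS](subr0 z); exact: eq_lquot.
split=> [z0|h].
  by have : cls z == cls 0; [rewrite z0 e0 | rewrite E0 => /asboolP].
by apply/eqP; rewrite -e0 E0; exact/asboolP.
Qed.

Let insp (h : homology f g) := exists (s : seq (Defs.cycle g)) (c : Defs.cycle g -> K),
  [/\ uniq s, {in s, forall z, E (val z)} & h = \sum_(z <- s) c z *: cls z].

(** Coefficients are a function of the cycle: for [z] already in [s], its value at [z] is increased,
    and as [s] is duplicate-free this counts once. *)
Lemma insp_add (a : K) z h : E (val z) -> insp h -> insp (a *: cls z + h).
Proof.
move=> Ez [s [c [us Es ->]]]; have [zs|zs] := boolP (z \in s).
  exists s, (fun t => c t + (if t == z then a else 0)); split=> //.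
  under [RHS]eq_bigr => t _ do rewrite scalerDl.
  rewrite big_split /= addrC; congr (_ + _).
  rewrite (bigD1_seq z) //= eqxx big1 ?addr0 // => t /negPf->.
  by rewrite scale0r.
exists (z :: s), (fun t => if t == z then a else c t); split.
- by rewrite /= zs.
- by move=> t; rewrite inE => /predU1P[->|/Es].
rewrite big_cons eqxx; congr (_ + _); apply: eq_big_seq => t ts.
by case: eqP => // e; rewrite -e ts in zs.
Qed.

Lemma insp_bspan v : bspan v -> forall z : Defs.cycle g, val z = v -> insp (cls z).
Proof.
elim=> [u|c e v' he _ IH] z zv.
  exists [::], (fun=> 0); split=> //; rewrite big_nil; apply/hclass_eq0.
  by exists u.
have ke : e \in kernel g by rewrite unfold_in; apply/eqP; exact: Ecycle.
have [ze zeE] : exists ze : Defs.cycle g, val ze = e by exists (Sub e ke); rewrite SubK.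
(* The difference is again a cycle, with underlying vector [v'], so the induction hypothesis covers
   it. *)
have -> : z = c *: ze + (z - c *: ze) by rewrite addrC subrK.
rewrite hclass_linear; apply: insp_add; first by rewrite zeE.
by apply: IH; rewrite raddfB /= linearZ /= zv scalerN [sval ze]zeE addrAC subrr add0r.
Qed.

Lemma basis_on_homology : basis_on (fun z : Defs.cycle g => E (val z)) cls.
Proof.
split=> [s c us Es s0|h].
  have [u hu] : exists u, f u = val (\sum_(z <- s) c z *: z).
    apply/hclass_eq0; rewrite -s0.
    pose L : {linear Defs.cycle g -> homology f g} := HB.pack cls
      (GRing.isLinear.Build _ _ _ _ cls hclass_linear).
    rewrite -[cls]/(L : _ -> _) linear_sum; apply: eq_bigr => z _.
    by rewrite linearZ.
  apply: (indepE us Es (u := u)); rewrite hu linear_sum; apply: eq_bigr => z _.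
  by rewrite linearZ.
have [z <-] : exists z, cls z = h.
  by exists (generic_quotient.repr h); exact: generic_quotient.reprK.
have [] := insp_bspan (spanE (v := val z) _) (erefl (val z)).
  by have := valP z; rewrite unfold_in => /eqP.
by move=> s [c [_ Es e]]; exists s, c.
Qed.

End HomologyBasis.

(** * Cyclic derivatives as sums over positions *)

Section CyclicSum.
Variables (k : fieldType) (A : algType k) (gen : letter -> A).

Lemma evw_lforms w : evw gen (lforms k w) = \prod_(l <- w) gen l.
Proof. by rewrite /evw big_map; apply: eq_bigr => l _; rewrite evf_lform. Qed.

Lemma cycd_lforms a w : cycd gen a (lforms k w) = \sum_(i < size w)
  ftens (\prod_(l <- drop i.+1 w) gen l * a * \prod_(l <- take i w) gen l)
    (lform k (nth X w i)).
Proof.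
elim: w a => [|l w IH] a; first by rewrite big_ord0.
rewrite big_ord_recl /= IH; congr (_ + _).
  by rewrite drop0 evw_lforms big_nil mulr1.
by apply: eq_bigr => i _; rewrite evf_lform big_cons !mulrA.
Qed.

End CyclicSum.

(** * Spanning of the cycles in [A (x) V_1] *)

Section Instance.
Variable k : fieldType.
Local Notation A := (Aalg k).
Local Notation gen := (@gen k).
Local Notation AV1 := (AV1 k).

Lemma ftens_lform (a : A) l : ftens a (lform k l) = tens a l.
Proof.
apply/ffunP => l'; rewrite [LHS]ffunE [RHS]ffunE lformE.
by case: (l' == l); rewrite ?scale1r ?scale0r.
Qed.

(** All infixes of the word satisfy [theta_adj], so the basis condition holds at every position and
    the sum is the full cyclic derivative. *)
Lemma theta1_cycd p (n m : 'I_p -> nat) :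
  (forall i, 0 < n i)%N -> (forall i, 0 < m i)%N ->
  theta1 k n m = cycd gen 1 (lforms k (theta_word n m)).
Proof.
move=> n0 m0; rewrite /theta1 cycd_lforms; set W := theta_word n m.
have cW : sorted theta_adj W.
  have : cycle theta_adj W.
    rewrite /W theta_word_blocks; apply: theta_blocks_cycle.
    by apply/allP => _ /mapP[i _ ->]; rewrite /pos_pair n0 m0.
  by case: W => //= l w; rewrite rcons_path => /andP[].
apply: eq_big => [i|i _].
  by rewrite !theta_adj_in_basis ?take_sorted ?drop_sorted.
by rewrite ftens_lform mulr1 (tnth_nth X).
Qed.

Lemma alpha1_ftens n : alpha1 k n = ftens (gen X ^+ n.-1) (lform k X).
Proof. by rewrite ftens_lform. Qed.

Lemma beta1_ftens n : beta1 k n = ftens (gen Y ^+ n.-1) (lform k Y).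
Proof. by rewrite ftens_lform. Qed.

Lemma gamma1_ftens n : gamma1 k n = ftens (gen Z ^+ n.-1) (lform k Z).
Proof. by rewrite ftens_lform. Qed.

Local Notation hspan := (bspan (@d2 k) (@HH1_basis_elt k)).

Lemma hspan_d2_gen (a : A) r : hspan (d2_gen a r).
Proof.
have -> : d2_gen a r = d2 [ffun r' => if r' == r then a else 0].
  have d20 r' : d2_gen (0 : A) r' = 0.
    by have := d2_gen_linear r' (-1) 0 (0 : A); rewrite scaler0 addr0 scaleN1r addNr.
  rewrite /d2 (bigD1 r) //= ffunE eqxx big1 ?addr0 // => r' /negPf ne.
  by rewrite ffunE ne d20.
exact: Bspan_bdry.
Qed.

Lemma cyclic_span_Aalg : cyclic_span gen hspan.
Proof.
split.
- by rewrite mulrDl; exact: Arel_xx.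
- exact: Arel_xz.
- exact: Arel_zy.
- exact: bspanD.
- exact: bspanZ.
- move=> a; have := hspan_d2_gen a Rxx; congr (hspan _).
  by rewrite cycd2 (evf_sform gen) /sform ftensDr !evf_lform !ftens_lform /= -addrA addrC.
- move=> a; have := hspan_d2_gen a Rxz; congr (hspan _).
  by rewrite cycd2 !evf_lform !ftens_lform addrC.
- move=> a; have := hspan_d2_gen a Rzy; congr (hspan _).
  by rewrite cycd2 !evf_lform !ftens_lform addrC.
- by move=> n; rewrite -(alpha1_ftens n.+1); apply: bspan_elt; exact: Alpha1.
- by move=> n; rewrite -(beta1_ftens n.+1); apply: bspan_elt; exact: Beta1.
- by move=> n; rewrite -(gamma1_ftens n.+1); apply: bspan_elt; exact: Gamma1.
move=> s s0 /allP hs; have hp (i : 'I_(size s)) := hs _ (mem_nth (0, 0)%N (ltn_ord i)).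
have n0 (i : 'I_(size s)) : (0 < (nth (0, 0) s i).1)%N by case/andP: (hp i).
have m0 (i : 'I_(size s)) : (0 < (nth (0, 0) s i).2)%N by case/andP: (hp i).
rewrite theta_blocks_word -[map _ _]/(lforms k _) -theta1_cycd //.
by apply: bspan_elt; apply: Theta1 => //; rewrite lt0n size_eq0.
Qed.

Lemma wordA_ind (P : A -> Prop) : P 0 ->
  (forall c a b, P a -> P b -> P (c *: a + b)) ->
  (forall w, P (wordA k w)) -> forall a, P a.
Proof.
move=> P0 PD Pw a; have [p <-] := @qproj_surj _ _ _ _ (relator_proper k) a.
rewrite [p]monalgE; elim: (X in \sum_(m <- X) _) => [|m s IH].
  by rewrite big_nil linear0.
have em : << p@_m *g m >> = p@_m *: fword k m.
  rewrite fwordE fmK; apply/malgP => m'.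
  by rewrite mcoeffZ !mcoeffU mulrnAr mulr1.
rewrite big_cons em; move: IH; set q := \sum_(_ <- _) _ => IH.
have := PD p@_m (wordA k m) _ (Pw m) IH.
by rewrite -pi_fword -linearP.
Qed.

(** The map sends [a] to its action on the basis vector that stands for 1. *)
Lemma normal_form_ex : exists Phi : {linear A -> {malg k[(nat * seq bool)%type]}},
  Phi 1 = << (0%N, [::]) >> /\ forall l a, Phi (gen l * a) = act l (Phi a).
Proof.
have [Phi Phiw] := wordA_lift_ex (@acts_xx k) (@acts_xz k) (@acts_zy k).
exists Phi; split; first by have := Phiw [::]; rewrite /wordA big_nil.
move=> l; have lin1 : linear (fun a => Phi (gen l * a)).
  by move=> c a b; rewrite mulrDr -scalerAr linearP.
have lin2 : linear (fun a => act l (Phi a)).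
  by move=> c a b; rewrite linearP act_linear.
apply: (linear_wordA_eq lin1 lin2) => w.
by have := Phiw (l :: w); rewrite /wordA big_cons /= => ->; rewrite Phiw.
Qed.

Lemma hspan_cycle (char0 : [pchar k] =i pred0) (v : AV1) : d1 v = 0 -> hspan v.
Proof.
have [Phi [Phi1 PhiM]] := normal_form_ex.
exact: (span_cycle cyclic_span_Aalg char0 Phi1 PhiM wordA_ind).
Qed.

End Instance.

(** * Linear independence by dual functionals *)

Section Duals.
Variable k : fieldType.
Local Notation A := (Aalg k).
Local Notation gen := (@gen k).
Local Notation AV1 := (AV1 k).
Implicit Types (w p q : seq letter).

Lemma d2_tens r w : d2_gen (wordA k w) r =
  match r with
  | Rxx => tens (wordA k (rcons w X)) X + tens (wordA k (rcons w Y)) X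
           + tens (wordA k (X :: w)) X + tens (wordA k (X :: w)) Y
  | Rxz => tens (wordA k (rcons w X)) Z + tens (wordA k (Z :: w)) X
  | Rzy => tens (wordA k (rcons w Z)) Y + tens (wordA k (Y :: w)) Z
  end.
Proof.
have wr l : wordA k (rcons w l) = wordA k w * gen l.
  by rewrite /wordA -cats1 big_cat big_seq1.
have wc l : wordA k (l :: w) = gen l * wordA k w by exact: big_cons.
rewrite !wr !wc; case: r => //=; rewrite mulrDr -!ftens_lform ftensDl //.
Qed.

Lemma letter_neqE : ((X == Y) = false) * ((Y == X) = false) * ((X == Z) = false) *
  ((Z == X) = false) * ((Y == Z) = false) * ((Z == Y) = false).
Proof. by do !split; apply/eqP. Qed.

(** The value of the functional on [w (x) l] is [G l w]. The first three conditions let it factor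
    through [A]; the last three make it vanish on the image of [d2]. *)
Lemma dual_ex (G : letter -> seq letter -> k) :
  (forall l p q, G l (p ++ [:: X; X] ++ q) + G l (p ++ [:: Y; X] ++ q) = 0) ->
  (forall l p q, G l (p ++ [:: X; Z] ++ q) = 0) ->
  (forall l p q, G l (p ++ [:: Z; Y] ++ q) = 0) ->
  (forall w, G X (rcons w X) + G X (rcons w Y) + G X (X :: w) + G Y (X :: w) = 0) ->
  (forall w, G Z (rcons w X) + G X (Z :: w) = 0) ->
  (forall w, G Y (rcons w Z) + G Z (Y :: w) = 0) ->
  exists psi : {linear AV1 -> k^o}, (forall u, psi (d2 u) = 0) /\
    forall w l, psi (tens (wordA k w) l) = G l w.
Proof.
move=> Gxx Gxz Gzy Rx Rz Ry.
have T l := wordA_lift_ex (V := k^o) (Gxx l) (Gxz l) (Gzy l).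
have [TX hX] := T X; have [TY hY] := T Y; have [TZ hZ] := T Z.
pose f (v : AV1) : k^o := TX (v X) + TY (v Y) + TZ (v Z).
have flin : linear f.
  move=> c u v; rewrite /f !ffunE !linearP !scalerDr.
  by rewrite [RHS]addrACA; congr (_ + _); rewrite [RHS]addrACA.
pose psi : {linear AV1 -> k^o} := HB.pack f (GRing.isLinear.Build _ _ _ _ f flin).
have psiE w l : psi (tens (wordA k w) l) = G l w.
  rewrite /psi /= /f !ffunE; case: l; rewrite ?eqxx !letter_neqE.
  - by rewrite !linear0 !addr0 hX.
  - by rewrite !linear0 addr0 add0r hY.
  - by rewrite !linear0 !add0r hZ.
exists psi; split=> // u.
rewrite /d2 linear_sum big1 // => r _.
have lin r' : linear (fun a => psi (d2_gen a r')).
  by move=> c a b; rewrite d2_gen_linear linearP.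
have lin0 : linear (fun=> 0 : k^o) by move=> c ? ?; rewrite scaler0 addr0.
apply: (linear_wordA_eq (lin r) (lin0 _)) => w.
by rewrite d2_tens; case: r; rewrite !linearD !psiE.
Qed.

(** The index [size W] is included so that [rot i.+1 W] is listed for every position [i]. *)
Definition rots (W : seq letter) := [seq rot i W | i <- iota 0 (size W).+1].

Lemma rots_adj W w p a b q : cycle theta_adj W -> w \in rots W ->
  w = p ++ [:: a; b] ++ q -> theta_adj a b.
Proof.
move=> cW /mapP[i _ ->] e; move: cW; rewrite -(rot_cycle i) e -(rot_cycle (size p)).
by rewrite rot_size_cat /= => /andP[].
Qed.

Lemma rots_wrap W w a b : cycle theta_adj W -> b :: rcons w a \in rots W ->
  theta_adj a b.
Proof.
move=> cW /mapP[i _ e]; move: cW; rewrite -(rot_cycle i) -e /=.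
by rewrite !rcons_path last_rcons => /andP[].
Qed.

Lemma cycd_rots W w : w \in rots W ->
  cycd gen 1 (lforms k w) = cycd gen 1 (lforms k W).
Proof.
move=> /mapP[i _ ->]; rewrite /lforms map_rot /rot cycd_rot.
by rewrite cat_take_drop.
Qed.

(** The functional tests whether [l] is not [x] and [wl] is a rotation of [W]. Forbidden
    adjacencies, also across the ends, make all terms in the conditions of [dual_ex] vanish. On a
    cyclic derivative it counts positions, and characteristic 0 keeps a positive count nonzero. *)
Lemma cyclic_dual W : [pchar k] =i pred0 -> cycle theta_adj W -> W != [::] ->
  exists psi : {linear AV1 -> k^o}, [/\ forall u, psi (d2 u) = 0,
    forall n, psi (alpha1 k n) = 0, psi (cycd gen 1 (lforms k W)) != 0 &
    forall w, psi (cycd gen 1 (lforms k w)) != 0 ->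
      exists i, rot i w \in rots W].
Proof.
move=> char0 cW W0.
have no w p a b q : ~~ theta_adj a b -> w = p ++ [:: a; b] ++ q -> w \in rots W = false.
  by move=> nab e; apply/negbTE/negP => /rots_adj/(_ e); rewrite (negPf nab) => /(_ cW).
have [||||||psi [psid psiE]] := @dual_ex (fun l w => ((l != X) && (rcons w l \in rots W))%:R).
- move=> l p q; rewrite !rcons_cat /=.
  rewrite (no _ p X X (rcons q l)) // (no _ p Y X (rcons q l)) //.
  by rewrite andbF addr0.
- by move=> l p q; rewrite !rcons_cat (no _ p X Z (rcons q l)) // andbF.
- by move=> l p q; rewrite !rcons_cat (no _ p Z Y (rcons q l)) // andbF.
- move=> w; rewrite eqxx !letter_neqE /= !add0r; case E: (_ \in _) => //.
  by have := rots_wrap cW E.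
- move=> w; have -> : (rcons (rcons w X) Z \in rots W) = false.
    by apply: (no _ w X Z [::]) => //; rewrite -!cats1 -catA.
  by rewrite andbF eqxx addr0.
- move=> w; have -> : (rcons (rcons w Z) Y \in rots W) = false.
    by apply: (no _ w Z Y [::]) => //; rewrite -!cats1 -catA.
  rewrite andbF add0r; case E: (_ \in _); last by rewrite andbF.
  by have := rots_wrap cW E.
have psiW w : psi (cycd gen 1 (lforms k w)) =
    (\sum_(i < size w) ((nth X w i != X) && (rot i.+1 w \in rots W)))%:R.
  rewrite cycd_lforms linear_sum natr_sum; apply: eq_bigr => i _.
  rewrite ftens_lform mulr1 -big_cat /= [psi _]psiE.
  by rewrite rcons_cat -take_nth.
exists psi; split=> //.
- move=> n; rewrite /alpha1.
  have -> : gen X ^+ n.-1 = wordA k (nseq n.-1 X).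
    by rewrite /wordA big_nseq -Monoid.iteropE.
  by rewrite psiE eqxx.
- rewrite psiW; have /pcharf0P -> := char0.
  (* As [xx] is forbidden cyclically, [W] has a letter other than [x]. *)
  have /(has_nthP X)[i ltiW Wi] : has (predC1 X) W.
    case: W cW W0 {psi psid psiE psiW no} => [|l [|l' W]] //=.
      by case: l; rewrite ?letter_neqE.
    by case: l; rewrite ?letter_neqE //=; case: l'; rewrite ?letter_neqE ?orbT.
  rewrite sum_nat_eq0; apply/forallPn; exists (Ordinal ltiW).
  rewrite implyTb eqb0 negbK -[_ != X]/(predC1 X _) Wi.
  by apply: (map_f (fun i => rot i W)); rewrite mem_iota ltnS.
move=> w; rewrite psiW; have /pcharf0P -> := char0.
rewrite sum_nat_eq0 => /forallPn[i]; rewrite implyTb eqb0 negbK => /andP[_ h].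
by exists i.+1.
Qed.

(** The functional takes the coefficient of [t^n] under [x -> t], [y -> -t], [z -> 0] in the first
    factor, with [x], [y], [z] sent to 1, -1, 0 in the second. *)
Lemma alpha_dual n : exists psi : {linear AV1 -> k^o},
  (forall u, psi (d2 u) = 0) /\
  forall m, (0 < m)%N -> psi (alpha1 k m) = (m == n.+1)%:R.
Proof.
pose h w : k := if (Z \notin w) && (size w == n) then (-1) ^+ count_mem Y w else 0.
have hz p q : Z \in p ++ q -> h (p ++ q) = 0 by rewrite /h => ->.
have hxy p q : h (p ++ X :: q) + h (p ++ Y :: q) = 0.
  rewrite /h !mem_cat !inE !letter_neqE !size_cat /= !count_cat /= !letter_neqE eqxx.
  case: ifP => _; last by rewrite addr0.
  by rewrite [(false + _)%N]add0n [(true + _)%N]add1n addnS exprS mulN1r subrr.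
have Zin p q r : Z \in r -> Z \in p ++ r ++ q by move=> zr; rewrite !mem_cat zr orbT.
have hxz p q : h (p ++ [:: X; Z] ++ q) = 0 by rewrite hz // Zin // !inE eqxx orbT.
have hzy p q : h (p ++ [:: Z; Y] ++ q) = 0 by rewrite hz // Zin // mem_head.
have [||||||psi [psid psiE]] := @dual_ex
  (fun l w => match l with X => h w | Y => - h w | Z => 0 end).
- by move=> [] p q; rewrite -?opprD ?(hxy p (X :: q)) ?oppr0 ?addr0.
- by move=> [] p q; rewrite ?hxz ?oppr0.
- by move=> [] p q; rewrite ?hzy ?oppr0.
- by move=> w; rewrite addrK -!cats1 hxy.
- by move=> w; rewrite add0r (hz [:: Z]) // mem_head.
- by move=> w; rewrite addr0 -cats1 hz ?oppr0 // mem_cat mem_head orbT.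
exists psi; split=> // -[//|m] _; rewrite /alpha1 /=.
have -> : gen X ^+ m = wordA k (nseq m X).
  by rewrite /wordA big_nseq -Monoid.iteropE.
rewrite psiE /h size_nseq eqSS mem_nseq !letter_neqE andbF /=.
by case: eqP => // _; rewrite count_nseq /= !letter_neqE mul0n expr0.
Qed.

(** The derivative of [y^n] is [n] times [beta1 k n], and likewise for [z]; the coefficient
    normalizes this. *)
Definition cyc_coef w : k :=
  if all (pred1 Y) w || all (pred1 Z) w then (size w)%:R^-1 else 1.

Lemma cyc_coef_rot i w : cyc_coef (rot i w) = cyc_coef w.
Proof. by rewrite /cyc_coef !(eq_all_r (mem_rot i w)) size_rot. Qed.

(** Words that agree up to rotation give the same element, so the elements of type (iv) are indexed
    by cyclic words. *)
Lemma rots_elt i W w : rot i w \in rots W ->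
  cyc_coef w *: cycd gen 1 (lforms k w) = cyc_coef W *: cycd gen 1 (lforms k W).
Proof.
move=> iw; have ec : cyc_coef w = cyc_coef W.
  by have /mapP[j _ e] := iw; rewrite -(cyc_coef_rot i w) e cyc_coef_rot.
rewrite ec -(cycd_rots iw) /lforms map_rot /rot.
by rewrite (cycd_rot _ (drop _ _)) cat_take_drop.
Qed.

Lemma basis_elt_cyclic (e : AV1) : [pchar k] =i pred0 -> HH1_basis_elt e ->
  (exists2 n, (0 < n)%N & e = alpha1 k n) \/
  exists2 W, cycle theta_adj W && (W != [::]) &
    e = cyc_coef W *: cycd gen 1 (lforms k W).
Proof.
move=> char0; have cn l n : theta_adj l l -> cycle theta_adj (nseq n.+1 l).
  move=> ll /=; rewrite -[l in rcons _ l]/(last l [:: l]) -cats1 /=.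
  by elim: n => /= [|n IH]; rewrite ll.
have nn n : n.+1%:R != 0 :> k by have /pcharf0P -> := char0.
case=> [n n0|[//|n] _|[//|n] _|p n m p0 n0 m0]; first by left; exists n.
- right; exists (nseq n.+1 Y); first by rewrite cn.
  have -> : cyc_coef (nseq n.+1 Y) = n.+1%:R^-1.
    by rewrite /cyc_coef !all_nseq size_nseq /= eqxx ?orbT.
  rewrite /lforms map_nseq cycd_nseq -scaler_nat scalerA mulVf // scale1r evf_lform.
  exact: beta1_ftens.
- right; exists (nseq n.+1 Z); first by rewrite cn.
  have -> : cyc_coef (nseq n.+1 Z) = n.+1%:R^-1.
    by rewrite /cyc_coef !all_nseq size_nseq /= eqxx ?orbT.
  rewrite /lforms map_nseq cycd_nseq -scaler_nat scalerA mulVf // scale1r evf_lform.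
  exact: gamma1_ftens.
right; exists (theta_word n m).
  rewrite {1}theta_word_blocks theta_blocks_cycle; last first.
    by apply/allP => _ /mapP[i _ ->]; rewrite /pos_pair n0 m0.
  by case: p n m p0 n0 m0 => // p n m _ _ _; rewrite /theta_word big_ord_recl.
rewrite (theta1_cycd k n0 m0) /cyc_coef.
case: p n m p0 n0 m0 => // p n m _ n0 m0; rewrite /theta_word big_ord_recl /=.
by rewrite !letter_neqE /= scale1r.
Qed.

Lemma basis_elt_cycle (e : AV1) : [pchar k] =i pred0 -> HH1_basis_elt e -> d1 e = 0.
Proof.
move=> char0 he; have [[n _ ->]|[W _ ->]] := basis_elt_cyclic char0 he.
  rewrite alpha1_ftens; apply: etrans (@bdry_ftens k A gen _ _) _.
  by rewrite evf_lform -exprSr -exprS subrr.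
have d10 : d1 (cycd gen 1 (lforms k W)) = 0.
  by apply: etrans (@bdry_cycd k A gen 1 _) _; rewrite mul1r mulr1 subrr.
by rewrite linearZ /= d10 scaler0.
Qed.

(** The coefficients of the elements other than the [alpha1] vanish first, by [cyclic_dual]. Only
    then is [alpha_dual] applied, since its functional may be nonzero on those elements. *)
Lemma basis_elt_indep (char0 : [pchar k] =i pred0)
    (s : seq (Defs.cycle (@d1 k))) (c : Defs.cycle (@d1 k) -> k) (u : AV2 k) :
  uniq s -> {in s, forall z, HH1_basis_elt (val z)} ->
  d2 u = \sum_(z <- s) c z *: val z -> {in s, forall z, c z = 0}.
Proof.
move=> us Es hu.
have cut (psi : {linear AV1 -> k^o}) z : z \in s -> (forall v, psi (d2 v) = 0) ->
    psi (val z) != 0 ->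
    (forall t, t \in s -> t != z -> c t = 0 \/ psi (val t) = 0) -> c z = 0.
  move=> zs psid psiz psit; have := psid u; rewrite hu linear_sum.
  rewrite (bigD1_seq z) //= big_seq_cond big1 ?addr0 => [|t /andP[ts tz]].
    by rewrite linearZ => /eqP; rewrite mulf_eq0 (negPf psiz) orbF => /eqP.
  by rewrite linearZ /=; case: (psit t ts tz) => ->; rewrite ?scale0r ?scaler0.
have cyc0 z : z \in s -> (exists2 W, cycle theta_adj W && (W != [::]) &
    val z = cyc_coef W *: cycd gen 1 (lforms k W)) -> c z = 0.
  move=> zs [W /andP[cW W0] zW].
  have [psi [psid psia psiW psiw]] := cyclic_dual char0 cW W0.
  have kW : cyc_coef W != 0.
    rewrite /cyc_coef; case: ifP => _; rewrite ?oner_eq0 // invr_eq0.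
    by have /pcharf0P -> := char0; rewrite size_eq0.
  apply: (cut psi) => //; first by rewrite zW linearZ mulf_neq0.
  move=> t ts tz; right; have [[n _ ->]|[w _ tw]] := basis_elt_cyclic char0 (Es t ts).
    exact: psia.
  (* A nonzero value makes [w] a rotation of [W], up to rotation the same word, so that [t] and [z]
     coincide. *)
  apply/eqP; apply: contraNT tz; rewrite tw linearZ mulf_eq0 negb_or => /andP[_ /psiw].
  move=> [i iw]; apply/eqP/val_inj; apply: etrans tw _; apply: etrans (rots_elt iw) _.
  exact: esym zW.
move=> z zs; have [[n n0 zn]|] := basis_elt_cyclic char0 (Es z zs); last exact: cyc0.
case: n n0 zn => // n _ zn; have [psi [psid psia]] := alpha_dual n.
apply: (cut psi) => //; first by rewrite zn psia // eqxx oner_eq0.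
move=> t ts tz; have [[m m0 tm]|tW] := basis_elt_cyclic char0 (Es t ts); last first.
  by left; exact: cyc0.
right; rewrite tm psia //; case: eqP => // e.
by case/eqP: tz; apply: val_inj; rewrite tm zn e.
Qed.

End Duals.

Theorem proposition3p1 (k : fieldType) (char0 : [pchar k] =i pred0) :
  (forall c : AV1 k, HH1_basis_elt c -> d1 c = 0) /\
  basis_on (fun z : Z1 k => HH1_basis_elt (val z)) (@HH1_class k).
Proof.
split=> [c|]; first exact: basis_elt_cycle.
apply: (basis_on_homology (f := @d2 k) (g := @d1 k) (E := @HH1_basis_elt k)).
- by move=> e; exact: basis_elt_cycle.
- exact: hspan_cycle.
- exact: basis_elt_indep.
Qed.
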